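(* Let $T,M\ge1$, let $\{f_n\}_{n\ge1}$ be a $T$-periodic sequence of probability densities (pre-change), and for $\ell=1,\dots,M$ let $\{g_n^{(\ell)}\}_{n\ge1}$ be a $T$-periodic sequence of probability densities (candidate post-change). Put $$I_\ell = \frac{1}{T}\sum_{i=1}^T D(g_i^{(\ell)} \,\|\, f_i),$$ and assume $0<I_\ell<\infty$ for every $\ell=1,\dots,M$. Let $$R_n = \sum_{\ell=1}^M \sum_{k=1}^n \prod_{i=k}^n \frac{g_{i}^{(\ell)}(X_{i})}{f_{i}(X_{i})},\qquad \tau_{sr} = \inf \{n \geq 1: R_n \geq \beta M\},$$ $$W_{n}^{(\ell)} = \max_{1\le k\le n}\sum_{i=k}^n\log\frac{g_i^{(\ell)}(X_i)}{f_i(X_i)},\qquad \tau_{cm} = \inf \Big\{n \geq 1: \max_{1 \leq \ell \leq M} W_{n}^{(\ell)} \geq \log (\beta M)\Big\}.$$ (1) The process $\{R_n-nM\}$ is a $\mathsf{P}_\infty$-martingale. (2) If $\mathsf{E}_\infty[R_{\tau_{sr}}]<\infty$, then $$\mathsf{E}_\infty[\tau_{cm}] \geq \mathsf{E}_\infty[\tau_{sr}] \geq \beta.$$ (3) If $(g_1^{(\ell)},\dots,g_T^{(\ell)})$ is the true post-change law, then as $\beta\to\infty$ $$\sup_{\nu\geq 1} \mathsf{E}_\nu [\tau_{cm} - \nu \mid \tau_{cm} \geq \nu] \leq \sup_{\nu\geq 1} \, \operatorname{ess\,sup}\, \mathsf{E}_\nu [\tau_{cm} - \nu \mid X_1, \cdots,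 X_{\nu-1}] \leq \frac{\log \beta}{I_\ell} (1 + o(1)).$$ (4) Consequently (when the condition in (2) holds, so that $\tau_{cm}$ satisfies the constraint $\mathsf{E}_\infty[\tau]\ge\beta$), $\tau_{cm}$ is asymptotically optimal as $\beta\to\infty$ with respect to the criteria of Lorden and Pollak, uniformly over each possible post-change hypothesis $(g_1^{(\ell)},\dots,g_T^{(\ell)})$, $\ell=1,\dots,M$.
   Context: Change point model: when $(g_1^{(\ell)},\dots,g_T^{(\ell)})$ is the true post-change law, $\mathsf{P}_\nu$ ($\nu\ge1$) denotes the law of the process $\{X_n\}_{n\ge1}$ of independent random variables such that $X_n$ has density $f_n$ for $n<\nu$ and density $g_n^{(\ell)}$ for $n\ge\nu$; $\mathsf{E}_\nu$ is the corresponding expectation. $\mathsf{P}_\infty,\mathsf{E}_\infty$ correspond to no change ($X_n\sim f_n$ for all $n$). $T$-periodic means $f_{n+T}=f_n$ and $g^{(\ell)}_{n+T}=g^{(\ell)}_n$ for all $n\ge1$. The statistics satisfy the recursion $W_{n+1}^{(\ell)}=\max\{W_n^{(\ell)},0\}+\log\frac{g_{n+1}^{(\ell)}(X_{n+1})}{f_{n+1}(X_{n+1})}$. Stopping times and martingales are with respect to the filtration generated by $\{X_n\}$. $D(g\,\|\,f)=\int g\log(g/f)$ is the Kullback-Leibler divergence. The essential supremum is the supremum outside a set of $\mathsf{P}_\nu$-measure zero. Conditional expectations given $\{\tau\ge\nu\}$ are considered only for those $\nu$ for which this event has positive probability. An $o(1)$ term goes to zero as $\beta\to\infty$ (with $M$,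 $T$ and the densities fixed). Criteria, subject to $\mathsf{E}_\infty[\tau]\ge\beta$: Pollak's criterion minimizes $\sup_{\nu\ge1}\mathsf{E}_\nu[\tau-\nu\mid\tau\ge\nu]$ over stopping times $\tau$; Lorden's criterion minimizes $\sup_{\nu\ge1}\operatorname{ess\,sup}\mathsf{E}_\nu[\tau-\nu\mid X_1,\dots,X_{\nu-1}]$. Asymptotic optimality means that, for each $\ell$ as true post-change law, the delay of $\tau_{cm}$ is at most $(1+o(1))$ times the infimum of the same delay metric over all stopping times $\tau$ with $\mathsf{E}_\infty[\tau]\ge\beta$, this infimum being at least $\frac{\log\beta}{I_\ell}(1+o(1))$. *)

(* Defs.v *)
From HB Require Import structures.
From mathcomp Require Import all_boot all_order all_algebra.
From mathcomp Require Import all_classical all_reals all_analysis.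
From mathcomp Require Import measurable_realfun ess_sup_inf lra.
Set Implicit Arguments.
Unset Strict Implicit.
Unset Printing Implicit Defensive.
Import Order.TTheory GRing.Theory Num.Theory.
Import numFieldNormedType.Exports.
Local Open Scope classical_set_scope.
Local Open Scope ring_scope.
Local Open Scope ereal_scope.

(* Sequences of densities, observations and statistics are functions on nat
   whose meaningful indices are 1, 2, ...; the value at 0 is never used. *)

Section densities.
Context {R : realType} {d : measure_display} {S : measurableType d}.
Variable mu : {measure set S -> \bar R}.

Definition is_density (h : S -> R) : Prop :=
  [/\ measurable_fun setT h, (forall x, (0 <= h x)%R) &
      \int[mu]_x (h x)%:E = 1].

Definition seq_periodic (T : nat) (h : nat -> S -> R) : Prop :=
  forall n, (1 <= n)%N -> h (n + T)%N = h n.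

(* The quotient is taken in the extended reals: it is +oo where f vanishes and
   g does not, and 0 where g vanishes. *)
Definition lratio (g f : S -> R) (x : S) : \bar R := (g x)%:E / (f x)%:E.

(* Since 0 * -oo = 0, the integrand vanishes where g does; it is +oo where
   only f vanishes, so a finite divergence forces g << f. *)
Definition KL (g f : S -> R) : \bar R :=
  \int[mu]_x ((g x)%:E * lne (lratio g f x)).

Definition information (T : nat) (g f : nat -> S -> R) : \bar R :=
  (T%:R^-1)%:E * \sum_(1 <= i < T.+1) KL (g i) (f i).

Definition change_density (f g : nat -> S -> R) (nu n : nat) : S -> R :=
  if (n < nu)%N then f n else g n.

End densities.

Section conditional_expectation.
Context {R : realType} {d : measure_display} {Omega : measurableType d}.
Implicit Types (P : probability Omega R) (F : set (set Omega))
  (Y Z : Omega -> \bar R).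

Definition sub_measurable F Y : Prop :=
  forall B, measurable B -> F (Y @^-1` B).

(* Z is a version of E_P[Y | F].  Meaningful for Y integrable or bounded from
   below, in which case versions are almost surely unique. *)
Definition is_condexp P F Y Z : Prop :=
  sub_measurable F Z /\
  (forall A, F A -> \int[P]_(w in A) Z w = \int[P]_(w in A) Y w).

(* A version exists, so the default is not used, for Y bounded from below, the
   only case needed here: see condexpP. *)
Definition condexp P F Y : Omega -> \bar R :=
  xget (cst +oo) [set Z | is_condexp P F Y Z].

Lemma condexp_exists_bounded P F Y (C : R) :
  sigma_algebra setT F -> F `<=` measurable -> measurable_fun setT Y ->
  (forall w, 0 <= Y w <= C%:E) ->
  exists2 Z, is_condexp P F Y Z & forall w, 0 <= Z w.
Proof.
move=> sF Fm mY Y0C.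
have Y0 w : 0 <= Y w by have /andP[] := Y0C w.
pose T' := g_sigma_algebraType F.
have FE (A : set T') : measurable A -> F A by rewrite /measurable/= sigma_algebra_id.
have EF (A : set T') : F A -> measurable A by rewrite /measurable/= sigma_algebra_id.
pose id' : Omega -> T' := id.
have mid : measurable_fun setT id'.
  by move=> _ B mB; rewrite setTI; apply/Fm/FE.
pose id'M : {mfun Omega >-> T'} := HB.pack id' (isMeasurableFun.Build _ _ _ _ _ mid).
pose P' : {finite_measure set T' -> \bar R} := distribution P id'M.
pose nu0 (A : set T') := \int[P]_(w in (A : set Omega)) Y w.
have nu00 : nu0 set0 = 0 by rewrite /nu0 integral_set0.
have nu0_ge0 A : 0 <= nu0 A by apply: integral_ge0.
have nu0_sa : semi_sigma_additive nu0.
  move=> G mG tG mUG.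
  apply: (@semi_sigma_additive_nng_induced _ _ _ P Y mY Y0) => //.
    by move=> i; apply/Fm/FE.
  exact/Fm/FE.
have nu0fin : fin_num_fun nu0.
  move=> A /FE/Fm mA; rewrite ge0_fin_numE//.
  apply: (@le_lt_trans _ _ (\int[P]_(w in A) (cst C%:E) w)).
    apply: ge0_le_integral => //.
    - exact: measurable_funTS.
    - by move=> w _ /=; have /andP[] := Y0C w.
  by rewrite integral_cst// ltey_eq fin_numM// fin_num_measure.
pose nu1 : {measure set T' -> \bar R} := HB.pack nu0
  (isMeasure.Build _ _ _ nu0 nu00 nu0_ge0 nu0_sa).
pose nu : {finite_measure set T' -> \bar R} := HB.pack (Measure.sort nu1)
  (Measure_isFinite.Build _ _ _ (Measure.sort nu1) nu0fin).
have nuP : nu `<< P'.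
  apply/null_content_dominatesP => A /FE/Fm mA P'A.
  by apply: null_set_integral => //; exact: measurable_funTS.
have [Z [Z0 iZ ZE]] := radon_nikodym_finite nuP.
have mZ : measurable_fun setT Z := measurable_int _ iZ.
exists Z => //; split.
  by move=> B mB; apply: FE; rewrite -[X in measurable X]setTI; exact: mZ.
move=> A FA; have mA := EF _ FA.
transitivity (nu A) => //; rewrite ZE// ge0_integral_pushforward//.
exact: measurable_funTS.
Qed.

Lemma condexpP P F Y (c : R) :
  sigma_algebra setT F -> F `<=` measurable -> measurable_fun setT Y ->
  (forall w, c%:E <= Y w) -> is_condexp P F Y (condexp P F Y).
Proof.
move=> sF Fm mY Yc.
suff [Z hZ] : exists Z, is_condexp P F Y Z by apply: xgetPex; exists Z.
pose V w := Y w - c%:E.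
have V0 w : 0 <= V w by rewrite sube_ge0.
have VK w : Y w = V w + c%:E by rewrite /V subeK.
have mV : measurable_fun setT V by apply: emeasurable_funB => //.
pose S n w := mine (V w) n.+1%:R%:E - mine (V w) n%:R%:E.
have minfin w n : mine (V w) n%:R%:E \is a fin_num.
  by rewrite ge0_fin_numE ?gt_min ?ltry ?orbT// le_min V0 lee_fin ler0n.
have S0 n w : 0 <= S n w.
  rewrite /S sube_ge0 ?minfin//.
  by rewrite le_min ge_min lexx/= ge_min lee_fin ler_nat leqnSn orbT.
have S1 n w : S n w <= n.+1%:R%:E.
  rewrite /S leeBlDr//; apply: (@le_trans _ _ n.+1%:R%:E).
    by rewrite ge_min lexx orbT.
  by rewrite leeDl// le_min V0 lee_fin ler0n.
have mS n : measurable_fun setT (S n).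
  by apply: emeasurable_funB; apply: measurable_mine => //.
have SE w : V w = \sum_(n <oo) S n w.
  apply/esym/cvg_lim => //.
  rewrite (_ : (fun _ => _) = (fun n => mine (V w) n%:R%:E)); last first.
    apply/funext => n; elim: n => [|n IH].
      by rewrite big_geq// /mine ltNge V0.
      by rewrite big_nat_recr//= IH /S [LHS]addeC subeK.
  have := V0 w; case: (V w) => [r||//] r0.
    apply: cvg_near_cst; near=> n.
    rewrite /mine ifT// lte_fin; near: n; exact: nbhs_infty_gtr.
  rewrite (_ : (fun n => _) = (fun n : nat => n%:R%:E)); last first.
    by apply/funext => n; rewrite /mine ltNge leey.
  by apply/cvgeryP; exact: cvgr_idn.
have /choice[Z hZ] : forall n, exists Z, is_condexp P F (S n) Z /\ forall w, 0 <= Z w.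
  move=> n; have [|Z ? ?] := @condexp_exists_bounded P F (S n) n.+1%:R sF Fm (mS n).
    by move=> w; rewrite S0 S1.
  by exists Z.
have mFZ n : sub_measurable F (Z n) by have [[]] := hZ n.
pose T' := g_sigma_algebraType F.
have TE (A : set T') : measurable A = F A by rewrite /measurable/= sigma_algebra_id.
have mTZ n : measurable_fun setT (Z n : T' -> \bar R).
  by move=> _ B mB; rewrite setTI TE; exact: mFZ.
have mOZ n : measurable_fun setT (Z n).
  by move=> _ B mB; rewrite setTI; apply/Fm/mFZ.
have Z0 n w : 0 <= Z n w by have [] := hZ n.
exists (fun w => \sum_(n <oo) Z n w + c%:E); split.
  have mT : measurable_fun setT ((fun w => \sum_(n <oo) Z n w + c%:E) : T' -> \bar R).
    by apply: emeasurable_funD => //; apply: ge0_emeasurable_sum.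
  by move=> B mB; rewrite -TE -[X in measurable X]setTI; exact: mT.
move=> A FA; have mA := Fm _ FA.
have shift (U : Omega -> \bar R) : measurable_fun setT U -> (forall w, 0 <= U w) ->
    \int[P]_(w in A) (U w + c%:E) = \int[P]_(w in A) U w + \int[P]_(w in A) c%:E.
  move=> mU U0; pose D w := U w + c%:E.
  have mD : measurable_fun setT D by exact: emeasurable_funD.
  have Dm w : D^\- w <= `|c|%:E.
    rewrite funenegE ge_max lee_fin normr_ge0 andbT /D leeNl -EFinN.
    apply: (@le_trans _ _ c%:E); first by rewrite lee_fin lerNl ler_normr lexx orbT.
    by rewrite leeDr.
  have imD : \int[P]_(w in A) D^\- w \is a fin_num.
    rewrite ge0_fin_numE; last by apply: integral_ge0.
    apply: (@le_lt_trans _ _ (\int[P]_(w in A) (cst `|c|%:E) w)).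
      by apply: ge0_le_integral => //; exact/measurable_funTS/measurable_funeneg.
    by rewrite integral_cst// ltey_eq fin_numM// fin_num_measure.
  pose p : R := Num.max c 0%R; pose m : R := Num.max (- c)%R 0%R.
  have cE : c = (p - m)%R.
    rewrite /p /m; have [h|h] := leP 0%R c.
      rewrite (max_idPr _) ?oppr_le0//; lra.
    by rewrite (max_idPl _) ?oppr_ge0 ?ltW//; lra.
  have p0 : (0 <= p)%R by rewrite /p le_max lexx orbT.
  have m0 : (0 <= m)%R by rewrite /m le_max lexx orbT.
  have pt w : D^\+ w + m%:E = U w + (p%:E + D^\- w).
    rewrite funeposE funenegE /D cE; have := U0 w; case: (U w) => [u _||//].
      rewrite -!EFinD -EFinN -!EFin_max -!EFinD; apply: (congr1 EFin).
      set x := (u + (p - m))%R; have [h|h] := leP 0%R x.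
        have -> : Num.max (- x)%R 0%R = 0%R by apply/max_idPr; rewrite oppr_le0.
        by rewrite /x; lra.
      have -> : Num.max (- x)%R 0%R = (- x)%R.
        by apply/max_idPl; rewrite oppr_ge0 ltW.
      by rewrite /x; lra.
    move=> _; rewrite /= [+oo + (p - m)%:E]addye//.
    by rewrite /maxe ltNge leey /= ltNy0.
  have int_eq : \int[P]_(w in A) (D^\+ w) + \int[P]_(w in A) m%:E =
      \int[P]_(w in A) U w + (\int[P]_(w in A) p%:E + \int[P]_(w in A) D^\- w).
    have mDp := measurable_funTS (D := A) (measurable_funepos mD).
    have mDn := measurable_funTS (D := A) (measurable_funeneg mD).
    rewrite -!ge0_integralD//.
    - by apply: eq_integral => w _; rewrite pt.
    - exact: measurable_funTS.
    - by move=> w _; rewrite adde_ge0.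
    - exact: emeasurable_funD.
  have [a aE] : exists a, P A = a%:E.
    by exists (fine (P A)); rewrite fineK// fin_num_measure.
  have icst k : \int[P]_(w in A) k%:E = (k * a)%:E.
    by rewrite integral_cst// EFinM; congr (_ * _); exact: aE.
  rewrite [LHS]integralE; move: int_eq; rewrite !icst.
  have : 0 <= \int[P]_(w in A) U w by exact: integral_ge0.
  have : 0 <= \int[P]_(w in A) D^\+ w by exact: integral_ge0.
  move: imD; case: (\int[P]_(w in A) D^\- w) => // x _.
  move: (\int[P]_(w in A) D^\+ w) (\int[P]_(w in A) U w) => [y||] [u||] //= _ _.
  rewrite -!EFinD => /(congr1 fine) /= e; apply: (congr1 EFin).
  by rewrite cE; lra.
under [RHS]eq_integral do rewrite VK.
rewrite !shift//; last 2 first.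
- by apply: ge0_emeasurable_sum.
- by move=> w; apply: nneseries_ge0.
congr (_ + _).
under [RHS]eq_integral do rewrite SE.
rewrite !integral_nneseries//; try by move=> n; exact: measurable_funTS.
by apply: eq_eseriesr => n _; have [[_ ->]] := hZ n.
Unshelve. all: by end_near. Qed.

Definition condexp_event P (A : set Omega) Y : \bar R :=
  (\int[P]_(w in A) Y w) / P A.

Definition martingale P (F : nat -> set (set Omega))
    (Y : nat -> Omega -> \bar R) : Prop :=
  forall n, [/\ sub_measurable (F n) (Y n), P.-integrable setT (Y n) &
                is_condexp P (F n) (Y n.+1) (Y n)].

End conditional_expectation.

Section process.
Context {R : realType} {dS d : measure_display} {S : measurableType dS}
  {Omega : measurableType d}.
Variable X : nat -> Omega -> S.
Implicit Types (tau : Omega -> \bar R).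

(* sigma(X_1, ..., X_n), which is {set0, setT} for n = 0 *)
Definition history (n : nat) : set (set Omega) :=
  <<s \bigcup_(i in [set i | (1 <= i <= n)%N])
        preimage_set_system setT (X i) measurable >>.

Definition mutually_independent (P : probability Omega R) : Prop :=
  forall (s : seq nat) (A : nat -> set S), uniq s -> all (leq 1) s ->
    (forall i, i \in s -> measurable (A i)) ->
    P (\bigcap_(i in [set` s]) X i @^-1` A i) =
    \prod_(i <- s) P (X i @^-1` A i).

(* Under P, the X_n (n >= 1) are independent and X_n has density h n. *)
Definition has_law (mu : {measure set S -> \bar R}) (P : probability Omega R)
    (h : nat -> S -> R) : Prop :=
  mutually_independent P /\
  (forall n (A : set S), (1 <= n)%N -> measurable A ->
    P (X n @^-1` A) = \int[mu]_(x in A) (h n x)%:E).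

Definition stopping_time tau : Prop :=
  (forall w, tau w = +oo \/ exists n : nat, tau w = n%:R%:E) /\
  (forall n : nat, history n [set w | tau w <= n%:R%:E]).

(* inf {n >= 1 : Y_n >= c}, with inf of the empty set equal to +oo *)
Definition first_passage (Y : nat -> Omega -> \bar R) (c : \bar R) :
    Omega -> \bar R :=
  fun w => ereal_inf [set n%:R%:E | n in [set n | (1 <= n)%N /\ c <= Y n w]].

(* Y_tau on {tau < +oo}, and 0 on {tau = +oo} *)
Definition stopped (Y : nat -> Omega -> \bar R) tau : Omega -> \bar R :=
  fun w => if tau w is r%:E then Y (Num.truncn r) w else 0.

(* In both delays, P nu is the law of the process with change point nu. *)
Definition pollak_delay (P : nat -> probability Omega R) tau : \bar R :=
  ereal_sup [set condexp_event (P nu) [set w | nu%:R%:E <= tau w]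
                   (fun w => tau w - nu%:R%:E)
            | nu in [set nu | (1 <= nu)%N /\
                              0 < P nu [set w | nu%:R%:E <= tau w]]].

Definition lorden_delay (P : nat -> probability Omega R) tau : \bar R :=
  ereal_sup [set ess_sup (P nu)
                   (condexp (P nu) (history nu.-1)
                      (fun w => tau w - nu%:R%:E))
            | nu in [set nu | (1 <= nu)%N]].

Definition feasible (Pinf : probability Omega R) (beta : R) :
    set (Omega -> \bar R) :=
  [set tau | stopping_time tau /\ beta%:E <= \int[Pinf]_w tau w].

Definition vanishes_at_infinity (e : R -> R) : Prop :=
  e x @[x --> +oo%R] --> 0%R.

(* delay l is the delay metric when hypothesis l is true and I l its
   information number.  The o(1) terms do not depend on l. *)
Definition asymptotically_optimal (Pinf : probability Omega R) (M : nat)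
    (I : 'I_M -> R) (delay : 'I_M -> (Omega -> \bar R) -> \bar R)
    (tau : R -> Omega -> \bar R) : Prop :=
  exists e1 e2 : R -> R,
    [/\ vanishes_at_infinity e1, vanishes_at_infinity e2 &
        \forall b \near +oo%R,
          feasible Pinf b (tau b) /\
          forall l : 'I_M,
            let opt := ereal_inf [set delay l t | t in feasible Pinf b] in
            delay l (tau b) <= (1 + e1 b)%:E * opt /\
            (ln b / I l * (1 + e2 b))%:E <= opt].

Variables (M : nat) (f : nat -> S -> R) (g : 'I_M -> nat -> S -> R).

Definition R_stat (n : nat) (w : Omega) : \bar R :=
  \sum_(l < M) \sum_(1 <= k < n.+1) \prod_(k <= i < n.+1)
    lratio (g l i) (f i) (X i w).

Definition W_stat (l : 'I_M) (n : nat) (w : Omega) : \bar R :=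
  \big[maxe/-oo]_(1 <= k < n.+1) \sum_(k <= i < n.+1)
    lne (lratio (g l i) (f i) (X i w)).

Definition tau_sr (beta : R) : Omega -> \bar R :=
  first_passage R_stat (beta * M%:R)%:E.

Definition tau_cm (beta : R) : Omega -> \bar R :=
  first_passage (fun n w => \big[maxe/-oo]_(l < M) W_stat l n w)
    (ln (beta * M%:R))%:E.

End process.

(* Main.v *)
Require Import Defs.
From HB Require Import structures.
From mathcomp Require Import all_boot all_order all_algebra.
From mathcomp Require Import all_classical all_reals all_analysis.
From mathcomp Require Import measurable_realfun ess_sup_inf ring lra zify.
Import Order.TTheory GRing.Theory Num.Theory.
Import numFieldNormedType.Exports.
Local Open Scope classical_set_scope.
Local Open Scope ring_scope.
Local Open Scope ereal_scope.
Set Implicit Arguments.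
Unset Strict Implicit.
Unset Printing Implicit Defensive.

(** Write z_i for the log-likelihood ratio of g_i to f_i and {tau >= i} for the
    event that a stopping time has not fired before i, which depends on the
    first i - 1 observations only.  The observation X_i is independent of that
    past, and this single fact ([integral_obs], [integral_history_obs]) carries
    the proof.

    Martingale and false alarms.  Each summand R^l of R satisfies the recursion
    R^l_(n+1) = (R^l_n + 1) * g(X_(n+1)) / f(X_(n+1)), and the ratio has mean 1
    under f, so R_n - n M is a martingale.  With a_n the integral of R_n over
    {tau_sr > n}, the same recursion and R >= beta M at the passage give
    beta M P(tau_sr = n + 1) + a_(n+1) <= a_n + M P(tau_sr > n).  Summing bounds
    beta P(tau_sr <= n) by the mean of tau_sr ([tau_sr_mean_ge]).  A single
    exp(W^l_n) is one summand of R_n, whence tau_sr <= tau_cm pointwise.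

    Upper bound on the delay.  After the change at nu = m + 1, as long as the
    walk sum z_i has not been stopped it lies below log(beta M).  Replacing z_i
    by min(z_i, b) bounds the overshoot by b, so the stopped walk never exceeds
    log(beta M) + b, while the Wald identity ([wald_truncated]) computes its
    integral over an event A of the past as the sum of a_i P(A, tau >= i), with
    a_i the mean of min(z_i, b).  These means are periodic and the weights
    decrease, so summation by parts ([periodic_weighted_sum_ge]) replaces a_i by
    its mean over a period at a bounded cost.  This bounds the delay on every A,
    hence the essential supremum ([lorden_tau_cm_le]); as b grows the mean over
    a period tends to I by dominated convergence ([capped_period_mean_cvg]).

    Lower bound on the delay.  Let q_i = P_oo(tau >= i).  If the mean of tau is
    at least beta, telescoping over windows of length K yields an m for which
    beta (q_(m+1) - q_(m+1+K)) <= 2 K q_(m+1): alarms in that window are rare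
    when there is no change ([exists_quiet_window]).  Put the change at m + 1.
    Integrating z >= c + 1 - exp(c - z) for the walk at the stopping time, with
    exp(- walk) the likelihood ratio of no change to change, turns rarity of the
    alarms under P_oo into a lower bound for the mean of the stopped walk
    ([stopped_information_ge]).  The Wald identity and summation by parts bound
    that mean above by I times the delay, up to a constant.  With
    c = log(beta / (2 K)) and K of order (log beta)^2, both log K / log beta and
    c / K vanish, which leaves log beta / I ([pollak_lower_asymptotics]).

    Pollak's delay never exceeds Lorden's ([pollak_le_lorden]), so one upper
    bound, for Lorden's, and one lower bound, for Pollak's, settle both
    criteria.  The error terms of the finitely many hypotheses are added up to
    make them uniform. *)

(** * Integrals determined by the law of a random variable *)

Section transfer.
Context {R : realType} {d1 d2 d3 : measure_display}.
Context {T1 : measurableType d1} {T2 : measurableType d2}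
  {T3 : measurableType d3}.
Variables (m1 : {measure set T1 -> \bar R}) (m2 : {measure set T2 -> \bar R}).
Import HBNNSimple.

(** Approximating k by simple functions reduces the integral of k(X) * p to the
    integrals of p over the preimages of sets.  Allowing p = +oo is what makes
    the pointwise convergence h_n(X) * p -> k(X) * p a case analysis. *)
Lemma integral_simple_approx (d : measure_display) (T : measurableType d)
    (m : {measure set T -> \bar R}) (X : T -> T3) (p : T -> \bar R)
    (k : T3 -> \bar R) (mk : measurable_fun setT k) :
  measurable_fun setT X -> measurable_fun setT p -> (forall w, 0 <= p w) ->
  (forall x, 0 <= k x) ->
  let h := nnsfun_approx measurableT mk in
  \int[m]_w (k (X w) * p w) =
  limn (fun n => \sum_(r \in range (h n)) r%:E *
     \int[m]_(w in X @^-1` (h n @^-1` [set r])) p w).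
Proof.
move=> mX mp p0 k0 h.
have mXA A : measurable A -> measurable (X @^-1` A).
  by move=> mA; rewrite -[X in measurable X]setTI; exact: mX.
have mhX n : measurable_fun setT (fun w => (h n (X w))%:E).
  apply/measurable_EFinP; apply: (@measurableT_comp _ _ _ _ _ _ (h n) _ X) => //.
have kE w : k (X w) * p w = limn (fun n => (h n (X w))%:E * p w).
  apply/esym/cvg_lim => //.
  have hk : (h n (X w))%:E @[n --> \oo] --> k (X w).
    by apply: cvg_nnsfun_approx.
  have hnd a b : (a <= b)%N -> (h a (X w) <= h b (X w))%R.
    by move=> ab; exact/lefP/nd_nnsfun_approx.
  have hle n : (h n (X w))%:E <= k (X w).
    have nd : nondecreasing_seq (fun i => (h i (X w))%:E).
      by move=> a b ab; rewrite lee_fin; exact: hnd.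
    rewrite -(cvg_lim _ hk)// (cvg_lim _ (ereal_nondecreasing_cvgn nd))//.
    by apply: ereal_sup_ubound; exists n.
  have := p0 w; case: (p w) => [r r0| _|//].
    by apply: cvgeZr.
  (* Here p w = +oo, so the product is 0 or +oo according as k (X w) vanishes. *)
  have [kX0|kX0] := eqVneq (k (X w)) 0.
    rewrite kX0 mul0e; apply: cvg_near_cst; apply: nearW => n.
    suff -> : h n (X w) = 0%R by rewrite mul0e.
    by apply/eqP; rewrite eq_le fun_ge0 andbT -lee_fin -[leRHS]kX0 hle.
  rewrite gt0_muley; last by rewrite lt_def kX0 k0.
  have [N hN] : exists N, (0 < h N (X w))%R.
    apply/not_existsP => h0; move/eqP: kX0; apply.
    rewrite -(cvg_lim _ hk)// (_ : (fun _ => _) = cst 0) ?lim_cst//.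
    apply/funext => n; congr EFin; apply/eqP; rewrite eq_le fun_ge0 andbT.
    by rewrite leNgt; apply/negP/h0.
  apply: cvg_near_cst; near=> n; rewrite gt0_muley// lte_fin (lt_le_trans hN)//.
  by apply/hnd; near: n; exact: nbhs_infty_ge.
under eq_integral do rewrite kE.
rewrite monotone_convergence//; last 3 first.
- by move=> n; apply: emeasurable_funM.
- by move=> n w _; rewrite mule_ge0// lee_fin.
- move=> w _ a b ab; rewrite lee_wpmul2r// lee_fin.
  exact/lefP/nd_nnsfun_approx.
congr (limn _); apply/funext => n.
transitivity (\int[m]_w (\sum_(r \in range (h n))
    r%:E * (p w * (\1_(X @^-1` (h n @^-1` [set r])) w)%:E))).
  apply: eq_integral => w _; rewrite fimfunE -fsumEFin// ge0_mule_fsuml//.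
    apply: eq_fsbigr => r rn.
    by rewrite EFinM -muleA (muleC (p w)); congr (_ * (_ * p w)).
  by move=> r; rewrite nnfun_muleindic_ge0.
have mind r : measurable (X @^-1` (h n @^-1` [set r])) by exact: mXA.
rewrite ge0_integral_fsum//; last 2 first.
- move=> r; apply: measurable_funeM; apply: emeasurable_funM => //.
  exact/measurable_EFinP.
- move=> r w _; have [r0|r0] := ltP r 0%R.
    rewrite indicE memNset ?mule0//=.
    by move=> E; move: r0; rewrite -E ltNge fun_ge0.
  by rewrite mule_ge0 ?lee_fin// mule_ge0// lee_fin.
apply: eq_fsbigr => r /[!inE] -[x _ <-].
rewrite ge0_integralZl//; last 3 first.
- by apply: emeasurable_funM => //; exact/measurable_EFinP.
- by move=> w _; rewrite mule_ge0// lee_fin.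
- by rewrite lee_fin.
by congr (_ * _); rewrite [RHS]integral_mkcond epatch_indic.
Unshelve. all: by end_near. Qed.

(** The integral of k(X) * p depends only on the image under X of the measure
    with density p.  Every change of variables between the sample space and the
    space of observations below is an instance, and the two weights make it
    cover independence as well. *)
Lemma integral_transfer (X1 : T1 -> T3) (X2 : T2 -> T3)
    (p1 : T1 -> \bar R) (p2 : T2 -> \bar R) (k : T3 -> \bar R) :
  measurable_fun setT X1 -> measurable_fun setT X2 ->
  measurable_fun setT p1 -> measurable_fun setT p2 ->
  (forall w, 0 <= p1 w) -> (forall w, 0 <= p2 w) ->
  (forall C, measurable C ->
    \int[m1]_(w in X1 @^-1` C) p1 w = \int[m2]_(w in X2 @^-1` C) p2 w) ->
  measurable_fun setT k -> (forall x, 0 <= k x) ->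
  \int[m1]_w (k (X1 w) * p1 w) = \int[m2]_w (k (X2 w) * p2 w).
Proof.
move=> mX1 mX2 mp1 mp2 p10 p20 E mk k0.
rewrite !(integral_simple_approx _ mk)//; congr (limn _).
by apply/funext => n; apply: eq_fsbigr => r _; rewrite E.
Qed.

End transfer.

(** * The observed past *)

Lemma ge0_integral_setC {R : realType} {d : measure_display}
    {Omega : measurableType d} (m : {measure set Omega -> \bar R})
    (p : Omega -> \bar R) B : measurable B -> measurable_fun setT p -> (forall w, 0 <= p w) ->
  \int[m]_(w in B) p w < +oo ->
  \int[m]_(w in ~` B) p w = \int[m]_w p w - \int[m]_(w in B) p w.
Proof.
move=> mB mp p0 fin.
have mBC := measurableC mB.
have dB : [disjoint ~` B & B] by apply/disj_set2P; rewrite setICl.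
rewrite -[in Z in Z - _](setvU B) ge0_integral_setU//; last first.
  by rewrite setvU.
by rewrite addeK// ge0_fin_numE//; exact: integral_ge0.
Qed.

Section history.
Context {R : realType} {dS d : measure_display} {S : measurableType dS}
  {Omega : measurableType d}.
Variable X : nat -> Omega -> S.

(** The generating sets of the history, named apart so that the sigma-algebra
    they generate can serve as the type of events of a measurable space. *)
Definition history_gen (n : nat) : set (set Omega) :=
  \bigcup_(i in [set i | (1 <= i <= n)%N])
    preimage_set_system setT (X i) measurable.

(** The sample space seen through the first n observations: measurability of
    a function of the past is measurability on this space, so that the closure
    properties of measurable functions apply to it. *)
Notation history_type n := (g_sigma_algebraType (history_gen n)).

Lemma measurable_historyE n (A : set (history_type n)) :
  measurable A = history X n A.
Proof. by []. Qed.

Lemma sub_measurableP n (Y : Omega -> \bar R) :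
  sub_measurable (history X n) Y <->
  measurable_fun setT (Y : history_type n -> \bar R).
Proof.
split=> mY B mB; first by move=> ?; rewrite setTI; exact: mY.
by rewrite -measurable_historyE -[Z in measurable Z]setTI; exact: mY.
Qed.

Lemma history_sigma n : sigma_algebra setT (history X n).
Proof. exact: smallest_sigma_algebra. Qed.

Lemma history_setT n : history X n setT.
Proof. exact: (@measurableT _ (history_type n)). Qed.

Lemma historyC n A : history X n A -> history X n (~` A).
Proof. exact: (@measurableC _ (history_type n)). Qed.

Lemma historyI n A B :
  history X n A -> history X n B -> history X n (A `&` B).
Proof. exact: (@measurableI _ (history_type n)). Qed.

Lemma historyD n A B :
  history X n A -> history X n B -> history X n (A `\` B).
Proof. exact: (@measurableD _ (history_type n)). Qed.

Lemma history_mono m n : (m <= n)%N -> history X m `<=` history X n.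
Proof.
move=> mn; apply: sub_sigma_algebra2 => A [i /= /andP[i1 im]] h.
by exists i => //=; rewrite i1 (leq_trans im).
Qed.

Lemma history_preimage n i A : (1 <= i <= n)%N -> measurable A ->
  history X n (X i @^-1` A).
Proof.
move=> i1n mA; apply: sub_sigma_algebra; exists i => //.
by exists A => //; rewrite setTI.
Qed.

Lemma measurable_history_obs n i : (1 <= i <= n)%N ->
  measurable_fun setT (X i : history_type n -> S).
Proof.
by move=> i1n _ B mB; rewrite setTI measurable_historyE; exact: history_preimage.
Qed.

Hypothesis mX : forall n, (1 <= n)%N -> measurable_fun setT (X n).

Lemma history_measurable n : history X n `<=` measurable.
Proof.
apply: smallest_sub; first exact: sigma_algebra_measurable.
by move=> _ [i /= /andP[i1 _]] [A mA <-]; exact: mX.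
Qed.

Lemma history_measurable_fun n (Y : Omega -> \bar R) :
  measurable_fun setT (Y : history_type n -> \bar R) -> measurable_fun setT Y.
Proof.
move=> mY _ B mB; apply: (@history_measurable n).
by rewrite -measurable_historyE; exact: mY.
Qed.

(** Rectangles in the first n observations, a generating class of the history
    stable under intersection, on which independence is a product formula. *)
Definition cylinder (n : nat) (A : nat -> set S) : set Omega :=
  \bigcap_(i in [set` iota 1 n]) X i @^-1` A i.

Lemma cylinder0 A : cylinder 0 A = setT.
Proof. by apply/seteqP; split. Qed.

Lemma cylinderS n A :
  cylinder n.+1 A = cylinder n A `&` X n.+1 @^-1` A n.+1.
Proof.
rewrite /cylinder -[n.+1 in LHS]addn1 iotaD/= add1n.
apply/seteqP; split=> w /=.
  move=> h; split=> [i /= ni|]; apply: h; rewrite /= mem_cat ?ni//.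
  by rewrite inE eqxx orbT.
by move=> [h1 h2] i /=; rewrite mem_cat inE => /orP[/h1//|/eqP->].
Qed.

Lemma eq_cylinder n A B : (forall i, (1 <= i <= n)%N -> A i = B i) ->
  cylinder n A = cylinder n B.
Proof.
move=> AB; apply: eq_bigcapr => i /=; rewrite mem_iota add1n ltnS => ?.
by rewrite AB.
Qed.

Lemma history_cylinder n A : (forall i, measurable (A i)) ->
  history X n (cylinder n A).
Proof.
move=> mA; elim: n => [|n IH]; first by rewrite cylinder0; exact: history_setT.
rewrite cylinderS; apply: historyI; first exact: (history_mono (leqnSn n)).
by apply: history_preimage => //; rewrite leqnn.
Qed.

Let cylinders n : set (set Omega) :=
  [set cylinder n A | A in [set A | forall i, measurable (A i)]].

Lemma setI_closed_cylinders n : setI_closed (cylinders n).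
Proof.
move=> _ _ [A mA <-] [B mB <-]; exists (fun i => A i `&` B i).
  by move=> i; exact: measurableI.
by rewrite /cylinder bigcapI.
Qed.

Lemma history_cylinders n : history X n = <<s cylinders n >>.
Proof.
apply/seteqP; split; last first.
  apply: smallest_sub; first exact: history_sigma.
  by move=> _ [A mA <-]; exact: history_cylinder.
apply: smallest_sub; first exact: smallest_sigma_algebra.
move=> _ [i /= i1n] [A mA <-]; apply: sub_sigma_algebra.
exists (fun j => if j == i then A else setT) => [j|].
  by case: ifP.
rewrite setTI; apply/seteqP; split=> w /=.
  by move=> /(_ i); rewrite /= eqxx; apply; rewrite mem_iota add1n ltnS.
by move=> Aw j _; rewrite /preimage/=; case: eqP => [->|].
Qed.

(** By Dynkin's theorem two finite indefinite integrals that agree on cylinders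
    agree on the whole history. *)
Lemma history_integral_eq n (m1 m2 : {measure set Omega -> \bar R})
    (p1 p2 : Omega -> \bar R) :
  measurable_fun setT p1 -> measurable_fun setT p2 ->
  (forall w, 0 <= p1 w) -> (forall w, 0 <= p2 w) ->
  \int[m1]_w p1 w < +oo ->
  (forall A, (forall i, measurable (A i)) ->
    \int[m1]_(w in cylinder n A) p1 w = \int[m2]_(w in cylinder n A) p2 w) ->
  forall B, history X n B ->
    \int[m1]_(w in B) p1 w = \int[m2]_(w in B) p2 w.
Proof.
move=> mp1 mp2 p10 p20 fin cyl B.
have ET : \int[m1]_w p1 w = \int[m2]_w p2 w.
  have := cyl (fun=> setT) (fun=> measurableT).
  suff -> : cylinder n (fun=> setT) = setT by [].
  by apply/seteqP; split.
rewrite history_cylinders.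
pose T' := g_sigma_algebraType (cylinders n).
have T'm (A : set T') : measurable A -> d.-measurable A.
  move=> mA; apply: (@history_measurable n); rewrite history_cylinders.
  exact: mA.
apply: (@dynkin_induction _ T' (cylinders n)
  (fun B => \int[m1]_(w in B) p1 w = \int[m2]_(w in B) p2 w)) => //.
- exact: setI_closed_cylinders.
- by move=> _ [A mA <-]; exact: cyl.
- move=> C /T'm mC EC; rewrite !ge0_integral_setC// -?EC -?ET//.
    by apply: le_lt_trans fin; exact: ge0_subset_integral.
  by apply: le_lt_trans fin; exact: ge0_subset_integral.
- move=> F mF tF EF; rewrite !ge0_integral_bigcup//.
  + by apply: eq_eseriesr => k _; exact: EF.
  + by move=> k; apply: T'm; exact: mF.
  + exact: measurable_funTS.
  + by move=> k; apply: T'm; exact: mF.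
  + exact: measurable_funTS.
Qed.

End history.
Notation history_type X n := (g_sigma_algebraType (history_gen X n)).

(** * Independence of the next observation from the past *)

Lemma probability_integral_indic (R : realType) (d : measure_display)
    (Omega : measurableType d) (P : probability Omega R) A B :
  measurable A -> measurable B ->
  \int[P]_(w in B) (\1_A w)%:E = P (A `&` B).
Proof. by move=> mA mB; exact: integral_indic. Qed.

Section independence.
Context {R : realType} {dS d : measure_display} {S : measurableType dS}
  {Omega : measurableType d}.
Variables (X : nat -> Omega -> S) (mu : {measure set S -> \bar R}).
Hypothesis mX : forall n, (1 <= n)%N -> measurable_fun setT (X n).
Variables (P : probability Omega R) (h : nat -> S -> R).
Hypothesis hd : forall n, (1 <= n)%N -> is_density mu (h n).
Hypothesis law : has_law X mu P h.

Lemma law_cylinder n A : (forall i, measurable (A i)) ->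
  P (cylinder X n A) = \prod_(i <- iota 1 n) P (X i @^-1` A i).
Proof.
move=> mA; have [indep _] := law; rewrite /cylinder indep//.
- exact: iota_uniq.
- by apply/allP => i; rewrite mem_iota => /andP[].
Qed.

(** Independence is assumed for events on single observations; it passes to the
    whole past because the past is generated by cylinders. *)
Lemma history_indep n B C : history X n B -> measurable C ->
  P (B `&` X n.+1 @^-1` C) = P B * P (X n.+1 @^-1` C).
Proof.
move=> hB mC; have mXC : measurable (X n.+1 @^-1` C).
  by rewrite -[Z in measurable Z]setTI; exact: mX.
have mB := history_measurable mX hB.
transitivity (\int[P]_(w in B) (\1_(X n.+1 @^-1` C) w)%:E).
  by rewrite integral_indic// setIC.
rewrite (@history_integral_eq _ _ _ _ _ X mX n P P _
  (cst (P (X n.+1 @^-1` C))))//.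
- by rewrite integral_cst// muleC.
- exact/measurable_EFinP.
- by rewrite integral_indic// setIT (le_lt_trans (probability_le1 _ _))// ltry.
- move=> A mA; have mcA : measurable (cylinder X n A).
    by apply: (history_measurable mX (n := n)); exact: history_cylinder.
  rewrite integral_cst// probability_integral_indic//.
  (* The event C on the next observation extends the cylinder by one factor. *)
  pose A' i := if i == n.+1 then C else A i.
  have -> : X n.+1 @^-1` C `&` cylinder X n A = cylinder X n.+1 A'.
    rewrite cylinderS setIC {2}/A' eqxx; congr (_ `&` _).
    by apply: eq_cylinder => i /andP[_ ni]; rewrite /A' ltn_eqF.
  rewrite -[LHS]/(P _) -[Z in _ * Z]/(P _) !law_cylinder//; last by move=> i; rewrite /A'; case: ifP.
  rewrite -[n.+1]addn1 iotaD big_cat/= big_seq1 add1n addn1 {2}/A' eqxx muleC.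
  congr (_ * _); rewrite !big_seq; apply: eq_bigr => i.
  by rewrite mem_iota add1n /A' => /andP[_ ni]; rewrite ltn_eqF.
Qed.

Lemma integral_obs n B (k : S -> \bar R) : history X n B ->
  measurable_fun setT k -> (forall x, 0 <= k x) ->
  \int[P]_(w in B) k (X n.+1 w) = P B * \int[mu]_x (k x * (h n.+1 x)%:E).
Proof.
move=> hB mk k0; have mB := history_measurable mX hB.
have [mh h0 _] := hd (ltn0Sn n).
have PB : P B \is a fin_num by exact: fin_num_measure.
transitivity (\int[P]_w (k (X n.+1 w) * (\1_B w)%:E)).
  by rewrite [LHS]integral_mkcond epatch_indic.
rewrite (@integral_transfer _ _ _ _ _ _ _ P mu _ id _
  (fun x => P B * (h n.+1 x)%:E))//.
- rewrite -ge0_integralZl//.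
  + by apply: eq_integral => x _; rewrite muleCA.
  + by apply: emeasurable_funM => //; exact/measurable_EFinP.
  + by move=> x _; rewrite mule_ge0// lee_fin.
- exact: mX.
- exact/measurable_EFinP.
- by apply: measurable_funeM; exact/measurable_EFinP.
- by move=> x; rewrite mule_ge0// lee_fin.
- move=> C mC; have mXC : measurable (X n.+1 @^-1` C).
    by rewrite -[Z in measurable Z]setTI; exact: mX.
  rewrite probability_integral_indic// history_indep//; have [_ ->//] := law.
  rewrite ge0_integralZl//.
  + by apply: measurable_funTS; exact/measurable_EFinP.
  + by move=> x _; rewrite lee_fin.
Qed.

(** A function of the past and a function of the next observation integrate to
    the product of their integrals. *)
Lemma integral_history_obs n (u : Omega -> \bar R) (k : S -> \bar R) :
  measurable_fun setT (u : history_type X n -> \bar R) ->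
  (forall w, 0 <= u w) ->
  measurable_fun setT k -> (forall x, 0 <= k x) ->
  \int[P]_w (u w * k (X n.+1 w)) =
  \int[P]_w u w * \int[mu]_x (k x * (h n.+1 x)%:E).
Proof.
move=> mu_ u0 mk k0; have [mh h0 _] := hd (ltn0Sn n).
have mu' := history_measurable_fun mX mu_.
have c0 : 0 <= \int[mu]_x (k x * (h n.+1 x)%:E).
  by apply: integral_ge0 => x _; rewrite mule_ge0// lee_fin.
rewrite -ge0_integralZr//.
have mid : measurable_fun setT (id : Omega -> history_type X n).
  by move=> _ B mB; rewrite setTI; exact: (history_measurable mX (n := n)).
apply: (@integral_transfer _ _ _ _ _ _ (history_type X n) P P id id
  (fun w => k (X n.+1 w)) (cst (\int[mu]_x (k x * (h n.+1 x)%:E))) u) => //.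
- by apply: (measurableT_comp mk); exact: mX.
- move=> C mC; rewrite integral_obs// integral_cst//; first by rewrite muleC.
  exact: (history_measurable mX (n := n)).
Qed.

End independence.

(** * Likelihood ratios and divergence of two densities *)

Section likelihood_ratio.
Context {R : realType} {d : measure_display} {S : measurableType d}.
Variable mu : {measure set S -> \bar R}.

(** A finite real everywhere, hence easier to sum than the extended logarithm;
    it is the logarithm of the likelihood ratio where both densities are
    positive, which is almost everywhere for the law of density g if the divergence is finite. *)
Definition llr (g f : S -> R) (x : S) : R := ln (g x / f x).

Lemma lratioE (g f : S -> R) x : f x != 0%R ->
  lratio g f x = (g x / f x)%:E.
Proof. by move=> f0; rewrite /lratio inver (negbTE f0) EFinM. Qed.

Lemma lratio0 (g f : S -> R) x : f x = 0%R -> (0 <= g x)%R ->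
  lratio g f x = if g x == 0%R then 0 else +oo.
Proof.
move=> f0 g0; rewrite /lratio f0 inve0; case: ifPn => [/eqP ->|gn0].
  by rewrite mul0e.
by rewrite gt0_muley// lte_fin lt_def gn0.
Qed.

Variables g f : S -> R.
Hypotheses (gd : is_density mu g) (fd : is_density mu f).

Lemma measurable_ratio : measurable_fun setT (fun x => g x / f x)%R.
Proof.
have [mg _ _] := gd; have [mf f0 _] := fd.
apply: measurable_funM => //.
rewrite (_ : (fun x => (f x)^-1) = (fun x => f x `^ (-1)))%R.
  exact: (measurableT_comp (@measurable_powR R (-1)%R)).
by apply/funext => x; rewrite powR_inv1.
Qed.

Lemma measurable_llr : measurable_fun setT (llr g f).
Proof. by apply: measurableT_comp => //; exact: measurable_ratio. Qed.

Lemma lratio_ge0 x : 0 <= lratio g f x.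
Proof.
have [_ g0 _] := gd; have [_ f0 _] := fd.
have [fx0|fx0] := eqVneq (f x) 0%R; first by rewrite lratio0//; case: ifP.
by rewrite lratioE// lee_fin divr_ge0.
Qed.

Lemma measurable_lratio : measurable_fun setT (lratio g f).
Proof.
have [mg g0 _] := gd; have [mf f0 _] := fd.
rewrite (_ : lratio g f = fun x => if f x == 0%R then
    if g x == 0%R then 0 else +oo else (g x / f x)%:E).
  apply: measurable_fun_ifT; first exact: measurable_fun_eqr.
    by apply: measurable_fun_ifT => //; exact: measurable_fun_eqr.
  by apply/measurable_EFinP; exact: measurable_ratio.
apply/funext => x; case: ifPn => [/eqP fx0|fx0]; first by rewrite lratio0.
by rewrite lratioE.
Qed.

Lemma lne_lratioE x : lne (lratio g f x) =
  if g x == 0%R then -oo else if f x == 0%R then +oo else (llr g f x)%:E.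
Proof.
have [_ g0 _] := gd; have [_ f0 _] := fd.
have [gx0|gx0] := eqVneq (g x) 0%R.
  by rewrite /lratio gx0 mul0e le0_lneNy.
have [fx0|fx0] := eqVneq (f x) 0%R.
  by rewrite lratio0// (negbTE gx0).
by rewrite lratioE// lne_EFin// divr_gt0// lt_def ?gx0 ?fx0 ?g0 ?f0.
Qed.

Lemma measurable_lne_lratio : measurable_fun setT (fun x => lne (lratio g f x)).
Proof.
have [mg g0 _] := gd; have [mf f0 _] := fd.
rewrite (_ : (fun x => _) = (fun x => if g x == 0%R then -oo else
  if f x == 0%R then +oo else (llr g f x)%:E)).
  apply: measurable_fun_ifT => //; first exact: measurable_fun_eqr.
  apply: measurable_fun_ifT => //; first exact: measurable_fun_eqr.
  by apply/measurable_EFinP; exact: measurable_llr.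
by apply/funext => x; exact: lne_lratioE.
Qed.

Let kl x : \bar R := (g x)%:E * lne (lratio g f x).

Let mkl : measurable_fun setT kl.
Proof.
have [mg _ _] := gd.
apply: emeasurable_funM; last exact: measurable_lne_lratio.
exact/measurable_EFinP.
Qed.

Let klE x : (f x = 0%R -> g x = 0%R) -> kl x = (llr g f x * g x)%:E.
Proof.
move=> fg; rewrite /kl lne_lratioE mulrC.
have [gx0|gx0] := eqVneq (g x) 0%R; first by rewrite gx0 mul0e mul0r.
have [fx0|fx0] := eqVneq (f x) 0%R; last by rewrite EFinM.
by move: gx0; rewrite fg// eqxx.
Qed.

(** From ln t <= t with t = f / g: the negative part of g ln(g / f) is at most
    f, so a divergence is always well defined. *)
Let kl_neg x : kl^\- x <= (f x)%:E.
Proof.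
have [_ g0 _] := gd; have [_ f0 _] := fd.
rewrite funenegE ge_max lee_fin f0 andbT /kl lne_lratioE.
have [gx0|gx0] := eqVneq (g x) 0%R; first by rewrite gx0 mul0e oppe0 lee_fin.
have gp : (0 < g x)%R by rewrite lt_def gx0 g0.
have [fx0|fx0] := eqVneq (f x) 0%R; first by rewrite gt0_muley ?lte_fin ?leNye.
have fp : (0 < f x)%R by rewrite lt_def fx0 f0.
rewrite -EFinM -EFinN lee_fin /llr -mulrN -lnV ?posrE ?divr_gt0// invf_div.
have := ln_sublinear (divr_gt0 fp gp) => /ltW h.
apply: le_trans (ler_wpM2l (ltW gp) h) _.
by rewrite mulrC divfK.
Qed.

Let int_kl_neg : \int[mu]_x kl^\- x <= 1.
Proof.
have [mf _ <-] := fd.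
apply: ge0_le_integral => //; first exact: measurable_funeneg.
exact/measurable_EFinP.
Qed.

Lemma KL_gtNy : -oo < KL mu g f.
Proof.
rewrite /KL integralE.
apply: (@lt_le_trans _ _ (0 - 1)); first by rewrite sub0e ltNyr.
by apply: leeB => //; exact: integral_ge0.
Qed.

Hypothesis KLfin : KL mu g f < +oo.

Let integrable_kl : mu.-integrable setT kl.
Proof.
apply/integrableP; split => //.
rewrite -[fun x => _]/(abse \o kl) fune_abse ge0_integralD//; last 2 first.
- exact: measurable_funepos.
- exact: measurable_funeneg.
have nfin : \int[mu]_x kl^\- x < +oo by apply: le_lt_trans int_kl_neg (ltry _).
apply: lte_add_pinfty => //.
move: KLfin; rewrite /KL integralE -/kl.
have : \int[mu]_x kl^\- x \is a fin_num.
  by rewrite ge0_fin_numE//; exact: integral_ge0.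
by move=> h; rewrite lteBlDr// => /lt_le_trans; apply; rewrite leey.
Qed.

(** Where f vanishes and g does not, the integrand of the divergence is +oo. *)
Lemma KL_abs_cont : {ae mu, forall x, f x = 0%R -> g x = 0%R}.
Proof.
have [_ g0 _] := gd.
have := integrable_ae measurableT integrable_kl; apply: filterS => x /(_ I).
move=> klf fx0; apply/eqP/negPn/negP => gx0; move: klf.
by rewrite /kl lne_lratioE (negbTE gx0) fx0 eqxx gt0_muley// lte_fin lt_def gx0 g0.
Qed.

Let ae_klE : ae_eq mu setT kl (fun x => (llr g f x * g x)%:E).
Proof. by have := KL_abs_cont; apply: filterS => x fg _; exact: klE. Qed.

Let mllrM : measurable_fun setT (fun x => (llr g f x * g x)%:E).
Proof.
have [mg _ _] := gd.
by apply/measurable_EFinP; apply: measurable_funM => //; exact: measurable_llr.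
Qed.

Lemma integrable_llr : mu.-integrable setT (fun x => (llr g f x * g x)%:E).
Proof.
have /integrableP[_ fin] := integrable_kl; apply/integrableP; split => //.
move: fin; rewrite (@ge0_ae_eq_integral _ _ _ mu setT (fun x => `|kl x|)
  (fun x => `|(llr g f x * g x)%:E|))//.
- exact: measurableT_comp.
- exact: measurableT_comp.
- by apply: filterS ae_klE => x h _; rewrite h.
Qed.

Lemma KL_llrE : KL mu g f = \int[mu]_x (llr g f x * g x)%:E.
Proof. by apply: ae_eq_integral => //. Qed.

Lemma KL_fin_num : KL mu g f \is a fin_num.
Proof. by rewrite KL_llrE; apply: integrable_fin_num => //; exact: integrable_llr. Qed.

(** The mean of the likelihood ratio under f is the mass of g where f does not
    vanish, which is all of it when the divergence is finite. *)
Lemma integral_lratio : \int[mu]_x (lratio g f x * (f x)%:E) = 1.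
Proof.
have [mg g0 <-] := gd; have [mf f0 _] := fd.
apply: ge0_ae_eq_integral => //.
- apply: emeasurable_funM; [exact: measurable_lratio|exact/measurable_EFinP].
- exact/measurable_EFinP.
- by move=> x _; rewrite mule_ge0// ?lratio_ge0// lee_fin.
- by move=> x _; rewrite lee_fin.
apply: filterS KL_abs_cont => x fg _.
have [fx0|fx0] := eqVneq (f x) 0%R; first by rewrite fx0 mule0 fg.
by rewrite lratioE// -EFinM divfK.
Qed.

Lemma density_support_null :
  \int[mu]_(x in [set x | (g x == 0%R) || (f x == 0%R)]) (g x)%:E = 0.
Proof.
have [mg g0 _] := gd; have [mf f0 _] := fd.
set C := [set x | _]; have mC : measurable C.
  rewrite (_ : C = (fun x => (g x == 0%R) || (f x == 0%R)) @^-1` [set true]).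
    rewrite -[Z in measurable Z]setTI; apply: measurable_or => //.
      exact: measurable_fun_eqr.
    exact: measurable_fun_eqr.
  by apply/seteqP; split => x /=.
rewrite (@ge0_ae_eq_integral _ _ _ mu C _ (cst 0)) ?integral0//.
- exact/measurable_funTS/measurable_EFinP.
- by move=> x _; rewrite lee_fin.
by apply: filterS KL_abs_cont => x fg /orP[/eqP ->//|/eqP/fg ->].
Qed.

End likelihood_ratio.

(** * Change of measure along the observations *)

Lemma probability_integral1 (R : realType) (d : measure_display)
    (Omega : measurableType d) (P : probability Omega R) A :
  measurable A -> \int[P]_(w in A) 1 = P A.
Proof. by move=> mA; rewrite integral_cst// mul1e. Qed.

Section change_of_measure.
Context {R : realType} {dS d : measure_display} {S : measurableType dS}
  {Omega : measurableType d}.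
Variables (X : nat -> Omega -> S) (mu : {measure set S -> \bar R}).
Hypothesis mX : forall n, (1 <= n)%N -> measurable_fun setT (X n).
Variables (P Q : probability Omega R) (p q : nat -> S -> R).
Hypothesis pd : forall n, (1 <= n)%N -> is_density mu (p n).
Hypothesis qd : forall n, (1 <= n)%N -> is_density mu (q n).
Hypothesis Plaw : has_law X mu P p.
Hypothesis Qlaw : has_law X mu Q q.

Lemma eq_history_law n : (forall i, (1 <= i <= n)%N -> p i = q i) ->
  forall B, history X n B -> P B = Q B.
Proof.
move=> pq B hB; have mB := history_measurable mX hB.
rewrite -(probability_integral1 P)// -(probability_integral1 Q)//.
apply: (@history_integral_eq _ _ _ _ _ X mX n P Q (cst 1) (cst 1)) => //.
  by rewrite /= probability_integral1// probability_setT ltry.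
move=> A mA; have mcA : measurable (cylinder X n A).
  by apply: (history_measurable mX (n := n)); exact: history_cylinder.
rewrite /= !probability_integral1// (law_cylinder Plaw)// (law_cylinder Qlaw)//.
rewrite !big_seq; apply: eq_bigr => i; rewrite mem_iota add1n ltnS => i1n.
have /andP[i1 _] := i1n.
by have [_ ->//] := Plaw; have [_ ->//] := Qlaw; rewrite pq.
Qed.

Lemma measurable_history_prod m n (a : nat -> S -> R) :
  (forall i, (m < i <= n)%N -> measurable_fun setT (a i)) ->
  measurable_fun setT
   ((fun w => (\prod_(m.+1 <= i < n.+1) a i (X i w))%:E) :
      history_type X n -> \bar R).
Proof.
move=> ma; apply/measurable_EFinP; apply: measurable_prod => i.
rewrite mem_index_iota ltnS => /andP[mi ni].
apply: (@measurableT_comp _ _ _ _ _ _ (a i) _ (X i : history_type X n -> S)).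
  by apply: ma; rewrite mi.
by apply: measurable_history_obs; rewrite ni (leq_ltn_trans _ mi).
Qed.

(** Replacing a law by another one term at a time: the pointwise identity
    a p = b q moves the factor from one density to the other.  The bound on a
    keeps the integrals finite, as passing to complements in
    Dynkin's theorem requires. *)
Lemma integral_prod_change m n (a b : nat -> S -> R) : (m <= n)%N ->
  (forall i, (1 <= i <= m)%N -> p i = q i) ->
  (forall i, (m < i <= n)%N -> measurable_fun setT (a i)) ->
  (forall i, (m < i <= n)%N -> measurable_fun setT (b i)) ->
  (forall i x, (m < i <= n)%N -> (0 <= a i x <= 1)%R) ->
  (forall i x, (m < i <= n)%N -> (0 <= b i x)%R) ->
  (forall i x, (m < i <= n)%N -> (a i x * p i x = b i x * q i x)%R) ->
  forall B, history X n B ->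
  \int[P]_(w in B) (\prod_(m.+1 <= i < n.+1) a i (X i w))%:E =
  \int[Q]_(w in B) (\prod_(m.+1 <= i < n.+1) b i (X i w))%:E.
Proof.
move=> mn pq; elim: n mn => [|n IH].
  rewrite leqn0 => /eqP -> _ _ _ _ _ B hB; under eq_integral do rewrite big_geq//.
  under [RHS]eq_integral do rewrite big_geq//.
  have mB := history_measurable mX hB; rewrite !probability_integral1//.
  by apply: (@eq_history_law 0) => // i; rewrite leqn0; case: i.
rewrite leq_eqVlt => /orP[/eqP <- _ _ _ _ _ B hB|].
  under eq_integral do rewrite big_geq//.
  under [RHS]eq_integral do rewrite big_geq//.
  have mB := history_measurable mX hB; rewrite !probability_integral1//.
  exact: (@eq_history_law m).
rewrite ltnS => mn ma mb a01 b0 ab.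
have sub i : (m < i <= n)%N -> (m < i <= n.+1)%N.
  by move=> /andP[-> /= h]; exact: (leq_trans h).
have mn1 : (m < n.+1 <= n.+1)%N by rewrite ltnS mn leqnn.
have hma := measurable_history_prod ma.
have hmb := measurable_history_prod mb.
have hma' := measurable_history_prod (fun i h => ma i (sub i h)).
have hmb' := measurable_history_prod (fun i h => mb i (sub i h)).
have pa k w : (k <= n.+1)%N -> (0 <= \prod_(m.+1 <= i < k.+1) a i (X i w) <= 1)%R.
  move=> kn; rewrite !big_seq; apply/andP; split.
    apply: prodr_ge0 => i; rewrite mem_index_iota ltnS => /andP[h1 h2].
    have hi : (m < i <= n.+1)%N by rewrite h1 (leq_trans h2).
    by have /andP[] := a01 i (X i w) hi.
  apply: prodr_ile1 => i; rewrite mem_index_iota ltnS => /andP[h1 h2].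
  by apply: a01; rewrite h1 (leq_trans h2).
have pb k w : (k <= n.+1)%N -> (0 <= \prod_(m.+1 <= i < k.+1) b i (X i w))%R.
  move=> kn; rewrite !big_seq.
  apply: prodr_ge0 => i; rewrite mem_index_iota ltnS => /andP[h1 h2].
  by apply: b0; rewrite h1 (leq_trans h2).
apply: (@history_integral_eq _ _ _ _ _ X mX).
- exact: (history_measurable_fun mX hma).
- exact: (history_measurable_fun mX hmb).
- by move=> w; rewrite lee_fin; have /andP[] := pa n.+1 w (leqnn _).
- by move=> w; rewrite lee_fin; exact: pb.
- apply: (@le_lt_trans _ _ (\int[P]_w cst 1 w)).
    apply: ge0_le_integral => //.
    + by move=> w _; rewrite lee_fin; have /andP[] := pa n.+1 w (leqnn _).
    + exact: (history_measurable_fun mX hma).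
    + by move=> w _; rewrite lee_fin; have /andP[] := pa n.+1 w (leqnn _).
  by rewrite /= probability_integral1// probability_setT ltry.
move=> A mA; rewrite cylinderS.
have key (P' : probability Omega R) (p' : nat -> S -> R) (a' : nat -> S -> R) :
    (forall n, (1 <= n)%N -> is_density mu (p' n)) ->
    has_law X mu P' p' ->
    measurable_fun setT ((fun w => (\prod_(m.+1 <= i < n.+1) a' i (X i w))%:E) :
      history_type X n -> \bar R) ->
    (forall w, (0 <= \prod_(m.+1 <= i < n.+1) a' i (X i w))%R) ->
    measurable_fun setT (a' n.+1) -> (forall x, (0 <= a' n.+1 x)%R) ->
    \int[P']_(w in cylinder X n A `&` X n.+1 @^-1` A n.+1)
       (\prod_(m.+1 <= i < n.+2) a' i (X i w))%:E =
    \int[P']_(w in cylinder X n A) (\prod_(m.+1 <= i < n.+1) a' i (X i w))%:E *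
    \int[mu]_(x in A n.+1) (a' n.+1 x * p' n.+1 x)%:E.
  move=> p'd lawP' mpr pr0 ma'n a'n0.
  rewrite [LHS]integral_mkcond [in Z in Z * _]integral_mkcond.
  rewrite [in Z in _ * Z]integral_mkcond !epatch_indic.
  transitivity (\int[P']_w (((\prod_(m.+1 <= i < n.+1) a' i (X i w))%:E *
      (\1_(cylinder X n A) w)%:E) *
      ((a' n.+1 (X n.+1 w))%:E * (\1_(A n.+1) (X n.+1 w))%:E))).
    apply: eq_integral => w _; rewrite big_nat_recr//= indicI/= EFinM.
    by rewrite -[\1_(X n.+1 @^-1` _) w]/(\1_(A n.+1) (X n.+1 w)) EFinM muleACA.
  rewrite (@integral_history_obs _ _ _ _ _ X mu mX P' p' p'd lawP' n
    (fun w => (\prod_(m.+1 <= i < n.+1) a' i (X i w))%:E *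
      (\1_(cylinder X n A) w)%:E)
    (fun x => (a' n.+1 x)%:E * (\1_(A n.+1) x)%:E)).
  + congr (_ * _); apply: eq_integral => x _.
    by rewrite EFinM muleAC.
  + apply: emeasurable_funM => //.
    by apply/measurable_EFinP; apply: measurable_indic; exact: history_cylinder.
  + by move=> w; rewrite mule_ge0// lee_fin.
  + by apply: emeasurable_funM => //; apply/measurable_EFinP => //; exact: measurable_indic.
  + by move=> w; rewrite mule_ge0// lee_fin.
rewrite (key P p)//; last 3 first.
- by move=> w; have /andP[] := pa n w (leqnSn _).
- exact: ma.
- by move=> x; have /andP[] := a01 n.+1 x mn1.
rewrite (key Q q)//; last 3 first.
- by move=> w; exact: pb.
- exact: mb.
- by move=> x; exact: b0.
congr (_ * _).
- apply: IH => //; last exact: history_cylinder.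
  + by move=> i /sub; exact: ma.
  + by move=> i /sub; exact: mb.
  + by move=> i x /sub; exact: a01.
  + by move=> i x /sub; exact: b0.
  + by move=> i x /sub; exact: ab.
- by apply: eq_integral => x _; rewrite ab.
Qed.

(** Only an inequality, because p may charge points where q vanishes; the
    quotient by zero is zero there, and the factor on the side of P is the
    indicator of q being nonzero. *)
Lemma change_of_measure_le m n : (m <= n)%N ->
  (forall i, (1 <= i <= m)%N -> p i = q i) ->
  forall B, history X n B ->
  \int[Q]_(w in B) (\prod_(m.+1 <= i < n.+1) (p i (X i w) / q i (X i w)))%:E
  <= P B.
Proof.
move=> mn pq B hB; have mB := history_measurable mX hB.
have qm i : (m < i)%N -> is_density mu (q i).
  by move=> mi; apply: qd; exact: (leq_ltn_trans _ mi).
have pm i : (m < i)%N -> is_density mu (p i).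
  by move=> mi; apply: pd; exact: (leq_ltn_trans _ mi).
(* This a satisfies a p = (p / q) q everywhere with the convention p / 0 = 0. *)
pose a i x : R := (q i x != 0%R)%:R.
have ma i : (m < i <= n)%N -> measurable_fun setT (a i).
  move=> /andP[mi _]; have [mq _ _] := qm i mi.
  rewrite (_ : a i = fun x => if q i x == 0%R then 0%R else 1%R).
    by apply: measurable_fun_ifT => //; exact: measurable_fun_eqr.
  by apply/funext => x; rewrite /a; case: eqP.
rewrite -(@integral_prod_change m n a (fun i x => p i x / q i x)%R)//; last 4 first.
- by move=> i /andP[mi _]; apply: (measurable_ratio (mu := mu)); [exact: pm|exact: qm].
- by move=> i x _; rewrite /a; case: (_ != _); rewrite ?lexx ?ler01.
- move=> i x /andP[mi _]; have [_ p0 _] := pm i mi; have [_ q0 _] := qm i mi.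
  exact: divr_ge0.
- move=> i x /andP[mi _]; have [_ p0 _] := pm i mi; have [_ q0 _] := qm i mi.
  rewrite /a; have [->|qx0] := eqVneq (q i x) 0%R; first by rewrite mul0r mulr0.
  by rewrite mul1r divfK.
have pa w : (0 <= \prod_(m.+1 <= i < n.+1) a i (X i w) <= 1)%R.
  rewrite prodr_ge0 ?prodr_ile1// => i _; rewrite /a; case: (_ != _) => /=;
  by rewrite ?lexx ?ler01.
apply: (@le_trans _ _ (\int[P]_(w in B) cst 1 w)).
  apply: ge0_le_integral => //.
  - by move=> w _; rewrite lee_fin; have /andP[] := pa w.
  - by apply: measurable_funTS; exact: (history_measurable_fun mX (measurable_history_prod ma)).
  - by move=> w _; rewrite lee_fin; have /andP[] := pa w.
by rewrite /= probability_integral1.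
Qed.

End change_of_measure.

(** * Stopping times and a truncated Wald identity *)

Section stopping_times.
Context {R : realType} {dS d : measure_display} {S : measurableType dS}
  {Omega : measurableType d}.
Variables (X : nat -> Omega -> S).
Hypothesis mX : forall n, (1 <= n)%N -> measurable_fun setT (X n).
Implicit Types (tau : Omega -> \bar R).

Definition not_before tau (i : nat) : set Omega := [set w | i%:R%:E <= tau w].

Lemma history_not_before tau n : stopping_time X tau ->
  history X n (not_before tau n.+1).
Proof.
move=> [tauN hist]; rewrite (_ : not_before _ _ = ~` [set w | tau w <= n%:R%:E]).
  by apply: historyC; exact: hist.
apply/seteqP; split => w; rewrite /not_before /=.
  have [->|[m ->]] := tauN w; rewrite ?lee_fin ?ler_nat//.
  by move=> nm; rewrite leqNgt nm.
have [->|[m ->]] := tauN w; rewrite ?leey ?lee_fin ?ler_nat//.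
by move/negP; rewrite -ltnNge.
Qed.

Lemma not_before_mono tau i j : (i <= j)%N -> not_before tau j `<=` not_before tau i.
Proof. by move=> ij w; apply: le_trans; rewrite lee_fin ler_nat. Qed.

Lemma measurable_not_before tau i : stopping_time X tau ->
  measurable (not_before tau i).
Proof.
case: i => [|n] st.
  rewrite (_ : not_before tau 0 = setT)//; apply/seteqP; split => // w _.
  by rewrite /not_before /=; have [->|[m ->]] := st.1 w; rewrite ?leey// lee_fin.
by apply: (history_measurable mX (n := n)); exact: history_not_before.
Qed.

(** The positive part of tau - nu counts the times after nu at which tau has not
    yet fired. *)
Lemma excess_series tau nu w : stopping_time X tau ->
  \sum_(k <oo) (\1_(not_before tau (nu + k).+1) w)%:E =
  maxe (tau w - nu%:R%:E) 0.
Proof.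
move=> [tauN _]; apply/cvg_lim => //.
have nbE i : \1_(not_before tau i) w = (nat_of_bool (i%:R%:E <= tau w))%:R :> R.
  rewrite indicE; suff -> : (w \in not_before tau i) = (i%:R%:E <= tau w) by [].
  by apply/idP/idP => [/set_mem//|?]; apply/mem_set.
have [tw|[m tw]] := tauN w.
  rewrite tw addye// (max_idPl _) ?leey//.
  rewrite (_ : (fun _ => _) = (fun n : nat => n%:R%:E)).
    by apply/cvgeryP; exact: cvgr_idn.
  apply/funext => n; rewrite (eq_bigr (fun=> 1%R%:E)) => [|i _].
    by rewrite sumEFin sumr_const_nat subn0.
  by rewrite nbE tw leey.
have -> : maxe (tau w - nu%:R%:E) 0 = (m - nu)%:R%:E.
  rewrite tw -EFinB -EFin_max; congr EFin; have [h|h] := leqP m nu.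
    rewrite (eqP (h : (m - nu == 0)%N)).
    by apply/max_idPr; rewrite subr_le0 ler_nat.
  rewrite natrB; last exact: ltnW.
  by apply/max_idPl; rewrite subr_ge0 ler_nat; exact: ltnW.
apply: cvg_near_cst; exists (m - nu)%N => // n /= nn.
rewrite (big_cat_nat _ (n := m - nu))//= [Z in _ + Z]big1_seq ?adde0 => [|i /=]; last first.
  rewrite mem_index_iota => /andP[mi _]; rewrite nbE tw lee_fin ler_nat.
  by rewrite ltnNge (_ : m <= nu + i)%N//; lia.
rewrite big_seq (eq_bigr (fun=> 1%R%:E)) => [|i]; last first.
  rewrite mem_index_iota => /= im; rewrite nbE tw lee_fin ler_nat.
  by rewrite (_ : (nu + i < m)%N = true)//; lia.
by rewrite -big_seq sumEFin sumr_const_nat subn0.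
Qed.

Lemma integral_excess (P : probability Omega R) tau nu A : stopping_time X tau ->
  measurable A ->
  \int[P]_(w in A) maxe (tau w - nu%:R%:E) 0 =
  \sum_(k <oo) P (A `&` not_before tau (nu + k).+1).
Proof.
move=> st mA; under eq_integral do rewrite -(excess_series _ _ st).
rewrite integral_nneseries//.
- apply: eq_eseriesr => k _; rewrite probability_integral_indic 1?setIC//.
  exact: measurable_not_before.
- move=> k; apply: measurable_funTS; apply/measurable_EFinP.
  by apply: measurable_indic; exact: measurable_not_before.
Qed.

Lemma measurable_stopping_time tau : stopping_time X tau -> measurable_fun setT tau.
Proof.
move=> st; have [tauN _] := st.
rewrite (_ : tau = fun w => \sum_(k <oo) (\1_(not_before tau (0 + k).+1) w)%:E).
  apply: ge0_emeasurable_sum => // k _; apply/measurable_EFinP.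
  by apply: measurable_indic; exact: measurable_not_before.
apply/funext => w; rewrite (excess_series _ _ st) sube0 (max_idPl _)//.
by have [->|[m ->]] := tauN w; rewrite ?leey// lee_fin.
Qed.

End stopping_times.

Section wald.
Context {R : realType} {dS d : measure_display} {S : measurableType dS}
  {Omega : measurableType d}.
Variables (X : nat -> Omega -> S) (mu : {measure set S -> \bar R}).
Hypothesis mX : forall n, (1 <= n)%N -> measurable_fun setT (X n).
Variables (P : probability Omega R) (h : nat -> S -> R).
Hypothesis hd : forall n, (1 <= n)%N -> is_density mu (h n).
Hypothesis law : has_law X mu P h.

Lemma integrable_obs n (y : S -> R) : measurable_fun setT y ->
  mu.-integrable setT (fun x => (y x * h n.+1 x)%:E) ->
  P.-integrable setT (fun w => (y (X n.+1 w))%:E).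
Proof.
move=> my iy; have [mh h0 _] := hd (ltn0Sn n).
have myX : measurable_fun setT (fun w => (y (X n.+1 w))%:E).
  by apply/measurable_EFinP; apply: (measurableT_comp my); exact: mX.
apply/integrableP; split => //.
rewrite (integral_obs mX hd law (n := n) (k := fun x => `|(y x)%:E|))//.
- move/integrableP : iy => [_]; rewrite probability_setT mul1e.
  congr (_ < _); apply: eq_integral => x _.
  by rewrite /= normrM EFinM (ger0_norm (h0 x)).
- exact: history_setT.
- by apply: measurableT_comp => //; exact/measurable_EFinP.
Qed.

Lemma integral_obs_real n (y : S -> R) B : measurable_fun setT y ->
  mu.-integrable setT (fun x => (y x * h n.+1 x)%:E) -> history X n B ->
  \int[P]_(w in B) (y (X n.+1 w))%:E =
  \int[mu]_x (y x * h n.+1 x)%:E * P B.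
Proof.
move=> my iy hB; have [mh h0 _] := hd (ltn0Sn n).
have PB : P B \is a fin_num by exact/fin_num_measure/(history_measurable mX hB).
have mY : measurable_fun setT (EFin \o y) by exact/measurable_EFinP.
have E1 x : (EFin \o y)^\+ x * (h n.+1 x)%:E =
    (fun x => (y x * h n.+1 x)%:E)^\+ x.
  by rewrite !funeposE /= EFinM maxe_pMl ?lee_fin// mul0e.
have E2 x : (EFin \o y)^\- x * (h n.+1 x)%:E =
    (fun x => (y x * h n.+1 x)%:E)^\- x.
  by rewrite !funenegE /= -mulNr EFinM maxe_pMl ?lee_fin// mul0e.
transitivity (P B * \int[mu]_x ((EFin \o y)^\+ x * (h n.+1 x)%:E) -
    P B * \int[mu]_x ((EFin \o y)^\- x * (h n.+1 x)%:E)).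
  rewrite [LHS]integralE; congr (_ - _).
  - transitivity (\int[P]_(w in B) (EFin \o y)^\+ (X n.+1 w)).
      by apply: eq_integral => w _; rewrite !funeposE.
    by rewrite (integral_obs mX hd law hB)//; exact: measurable_funepos.
  - transitivity (\int[P]_(w in B) (EFin \o y)^\- (X n.+1 w)).
      by apply: eq_integral => w _; rewrite !funenegE.
    by rewrite (integral_obs mX hd law hB)//; exact: measurable_funeneg.
under eq_integral do rewrite E1.
under [in Z in _ - _ * Z]eq_integral do rewrite E2.
rewrite [in RHS]integralE.
have /fineK <- := integrable_pos_fin_num measurableT iy.
have /fineK <- := integrable_neg_fin_num measurableT iy.
by rewrite [RHS]muleC muleBr.
Qed.

(** Since {tau >= i} belongs to the past of X_i, each term of the stopped sum
    integrates to its mean times a probability.  The sum stops at a fixed n, so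
    no integrability of tau is involved. *)
Lemma wald_truncated m (y : nat -> S -> R) (a : nat -> R)
    (tau : Omega -> \bar R) A n :
  stopping_time X tau -> history X m A ->
  (forall i, (m < i)%N -> measurable_fun setT (y i)) ->
  (forall i, (m < i)%N -> mu.-integrable setT (fun x => (y i x * h i x)%:E)) ->
  (forall i, (m < i)%N -> \int[mu]_x (y i x * h i x)%:E = (a i)%:E) ->
  let U w := (\sum_(m.+1 <= i < n.+1)
    y i (X i w) * \1_(not_before tau i) w)%R in
  P.-integrable setT (fun w => (U w)%:E) /\
  \int[P]_(w in A) (U w)%:E =
  \sum_(m.+1 <= i < n.+1) (a i)%:E * P (A `&` not_before tau i).
Proof.
move=> st hA my iy ay; have mA := history_measurable mX hA.
have mN i := measurable_not_before mX i st.
have iyX i : (m < i)%N -> P.-integrable setT (fun w => (y i (X i w))%:E).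
  by case: i => // i mi; apply: integrable_obs; [exact: my|exact: iy].
have iU i : (m < i)%N ->
    P.-integrable setT (fun w => (y i (X i w) * \1_(not_before tau i) w)%:E).
  move=> mi; apply: le_integrable (iyX i mi) => //.
    apply/measurable_EFinP; apply: measurable_funM => //.
    by apply/measurable_EFinP; apply: measurable_int (iyX i mi).
  move=> w _; rewrite /= lee_fin normrM ler_piMr// indicE.
  by case: (_ \in _); rewrite ?normr1 ?normr0.
elim: n => [|n [IH1 IH2]] U.
  rewrite /U; under eq_fun do rewrite big_geq//.
  by rewrite big_geq// integral0; split => //; exact: integrable0.
have [nm|mn] := leqP n.+1 m.
  rewrite /U; under eq_fun do rewrite big_geq//.
  by rewrite big_geq// integral0; split => //; exact: integrable0.
have -> : (fun w => (U w)%:E) = (fun w => (\sum_(m.+1 <= i < n.+1)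
    y i (X i w) * \1_(not_before tau i) w)%:E +
    (y n.+1 (X n.+1 w) * \1_(not_before tau n.+1) w)%:E).
  by apply/funext => w; rewrite /U big_nat_recr//= EFinD.
split; first by apply: integrableD => //; exact: iU.
rewrite integralD//; last 2 first.
- by apply: integrableS IH1.
- by apply: integrableS (iU n.+1 mn).
rewrite IH2 [RHS]big_nat_recr//=; congr (_ + _).
transitivity (\int[P]_(w in A `&` not_before tau n.+1) (y n.+1 (X n.+1 w))%:E).
  rewrite [RHS]integral_mkcondr; apply: eq_integral => w _.
  by rewrite epatch_indic EFinM.
rewrite integral_obs_real ?ay//; [exact: my|exact: iy|].
apply: historyI; last exact: history_not_before.
by apply: (history_mono (m := m)) => //.
Qed.

End wald.

(** * Weighted sums of periodic sequences *)

Section periodic.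
Context {R : realType}.
Implicit Types (a b p : nat -> R).

Local Open Scope ring_scope.

(** Summation by parts: partial sums bounded below by - C stay bounded below by
    - C times the first weight once decreasing weights are applied. *)
Lemma abel_lower_bound a p C m n :
  (forall i, (m < i)%N -> 0 <= p i.+1 <= p i) -> 0 <= p m.+1 -> 0 <= C ->
  (forall k, (m <= k)%N -> - C <= \sum_(m.+1 <= i < k.+1) a i) ->
  - (C * p m.+1) <= \sum_(m.+1 <= i < n.+1) a i * p i.
Proof.
move=> hp p0 C0 hC.
have pdec k : 0 <= p (m + k).+1 <= p m.+1.
  elim: k => [|k /andP[_ IH]]; first by rewrite addn0 p0 lexx.
  rewrite addnS; have /andP[-> h] := hp (m + k).+1 (leq_addr _ _).
  exact: le_trans IH.
have key k : - (C * (p m.+1 - p (m + k).+1)) + (\sum_(m.+1 <= i < (m + k).+1) a i) *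
    p (m + k).+1 <= \sum_(m.+1 <= i < (m + k).+1) a i * p i.
  elim: k => [|k IH].
    by rewrite addn0 !big_geq// subrr mulr0 oppr0 mul0r addr0.
  rewrite addnS !(big_nat_recr (m + k).+1)/= ?ltnS ?leq_addr//.
  have /andP[q0 qp] := hp (m + k).+1 (leq_addr _ _).
  have := hC (m + k).+1 (leqW (leq_addr _ _)).
  rewrite !(big_nat_recr (m + k).+1)/= ?ltnS ?leq_addr//.
  move: IH (pdec k).
  set s := \sum_(_ <= i < _) a i; set t := \sum_(_ <= i < _) _.
  move: (p (m + k).+1) (p (m + k).+2) (p m.+1) (a (m + k).+1) q0 qp => x y z u yp yx h1 h2 h3.
  have : 0 <= (s + u + C) * (x - y) by rewrite mulr_ge0 ?subr_ge0//; lra.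
  nra.
have [nm|mn] := leqP n m.
  by rewrite big_geq ?ltnS// oppr_le0 mulr_ge0.
have := key (n - m)%N; rewrite subnKC; last exact: ltnW.
apply: le_trans.
have := hC n (ltnW mn); have := pdec (n - m)%N; rewrite subnKC; last exact: ltnW.
move=> /andP[h1 h2] h3.
have := ler_wpM2r h1 h3; rewrite mulrBr; lra.
Qed.

Variable T : nat.
Hypothesis T1 : (1 <= T)%N.
Variable a : nat -> R.
Hypothesis aper : forall n, (1 <= n)%N -> a (n + T)%N = a n.

(** A periodic sequence with mean zero has periodic partial sums. *)
Lemma periodic_sum_bound m k : \sum_(1 <= i < T.+1) a i = 0 ->
  `|\sum_(m.+1 <= i < k.+1) a i| <= 2 * \sum_(1 <= i < T.+1) `|a i|.
Proof.
move=> a0; pose E n := \sum_(1 <= i < n.+1) a i.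
have C0 : 0 <= \sum_(1 <= i < T.+1) `|a i| by apply: sumr_ge0.
have ES n : E n.+1 = E n + a n.+1 by rewrite /E big_nat_recr.
have EP n : E (n + T)%N = E n.
  elim: n => [|n IH]; first by rewrite add0n /E a0 big_geq.
  by rewrite addSn !ES IH -addSn aper.
have Emod n : E n = E (n %% T)%N.
  rewrite [in LHS](divn_eq n T); elim: (n %/ T)%N => [|q IH]; first by rewrite mul0n add0n.
  by rewrite mulSn -addnA addnC EP.
have Ebound n : `|E n| <= \sum_(1 <= i < T.+1) `|a i|.
  rewrite Emod; have nT : (n %% T < T)%N by rewrite ltn_mod.
  apply: le_trans (ler_norm_sum _ _ _) _.
  rewrite [leRHS](@big_cat_nat _ _ _ (n %% T).+1)//= ?ltnS; last exact: ltnW.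
  by rewrite lerDl sumr_ge0.
have [km|mk] := leqP k m.
  by rewrite big_geq ?ltnS// normr0 mulr_ge0.
have -> : \sum_(m.+1 <= i < k.+1) a i = E k - E m.
  rewrite /E [in X in X - _](@big_cat_nat _ _ _ m.+1)//= ?ltnS; last exact: ltnW.
  by rewrite addrAC subrr add0r.
apply: le_trans (ler_normB _ _) _.
have := Ebound k; have := Ebound m; lra.
Qed.

End periodic.

Definition period_mean {R : realType} (T : nat) (a : nat -> R) : R :=
  (T%:R^-1 * \sum_(1 <= i < T.+1) a i)%R.

(** Bounds the partial sums of the centred sequence, from any starting index
    and of any length. *)
Definition period_deviation {R : realType} (T : nat) (a : nat -> R) : R :=
  (2 * \sum_(1 <= i < T.+1) `|a i - period_mean T a|)%R.

Lemma period_deviation_ge0 {R : realType} T (a : nat -> R) :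
  (0 <= period_deviation T a)%R.
Proof. by rewrite mulr_ge0// sumr_ge0. Qed.

(** Under decreasing weights a periodic sequence acts as its mean, up to
    an error that does not depend on the number of terms. *)
Lemma periodic_weighted_sum_ge {R : realType} (T : nat) (a p : nat -> R) m n :
  (1 <= T)%N -> (forall n, (1 <= n)%N -> a (n + T)%N = a n) ->
  (forall i, (m < i)%N -> 0 <= p i.+1 <= p i)%R -> (0 <= p m.+1)%R ->
  (period_mean T a * \sum_(m.+1 <= i < n.+1) p i - period_deviation T a * p m.+1 <=
   \sum_(m.+1 <= i < n.+1) a i * p i)%R.
Proof.
move=> T1 aper hp p0; set abar := period_mean T a; set C := period_deviation T a.
have zero : (\sum_(1 <= i < T.+1) (a i - abar) = 0)%R.
  rewrite big_split/= sumr_const_nat subn1/= -mulr_natr mulNr.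
  by rewrite /abar /period_mean mulrAC mulVf ?mul1r ?subrr// pnatr_eq0 -lt0n.
have C0 : (0 <= C)%R by exact: period_deviation_ge0.
have hper k : (1 <= k)%N -> (a (k + T)%N - abar = a k - abar)%R.
  by move=> k1; rewrite aper.
have hC k : (m <= k)%N -> (- C <= \sum_(m.+1 <= i < k.+1) (a i - abar))%R.
  move=> mk; have := periodic_sum_bound T1 hper m k zero.
  by rewrite ler_norml => /andP[].
have := abel_lower_bound n hp p0 C0 hC.
rewrite mulr_sumr (eq_bigr (fun i => a i * p i - abar * p i)%R); last first.
  by move=> i _; rewrite mulrBl.
rewrite sumrB; lra.
Qed.

Lemma periodic_weighted_sum_le {R : realType} (T : nat) (a p : nat -> R) m n :
  (1 <= T)%N -> (forall n, (1 <= n)%N -> a (n + T)%N = a n) ->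
  (forall i, (m < i)%N -> 0 <= p i.+1 <= p i)%R -> (0 <= p m.+1)%R ->
  (\sum_(m.+1 <= i < n.+1) a i * p i <=
   period_mean T a * \sum_(m.+1 <= i < n.+1) p i + period_deviation T a * p m.+1)%R.
Proof.
move=> T1 aper hp p0.
have meanN : period_mean T (fun i => - a i)%R = (- period_mean T a)%R.
  by rewrite /period_mean sumrN mulrN.
have devN : period_deviation T (fun i => - a i)%R = period_deviation T a.
  rewrite /period_deviation meanN; congr (_ * _)%R; apply: eq_bigr => i _.
  by rewrite -opprD normrN.
have sumN : (\sum_(m.+1 <= i < n.+1) - a i * p i =
    - \sum_(m.+1 <= i < n.+1) a i * p i)%R.
  by rewrite -sumrN; apply: eq_bigr => i _; rewrite mulNr.
have aNper k : (1 <= k)%N -> (- a (k + T)%N = - a k)%R by move=> k1; rewrite aper.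
have := periodic_weighted_sum_ge n T1 aNper hp p0.
by rewrite meanN devN sumN mulNr; lra.
Qed.

(** * Bounding the two delay criteria *)

(** Monotonicity without sign or integrability assumptions, obtained separately
    for positive and negative parts. *)
Lemma ae_le_integral_measurable {R : realType} {d : measure_display}
    {T : measurableType d} (m : {measure set T -> \bar R}) A
    (f g : T -> \bar R) :
  measurable A -> measurable_fun A f -> measurable_fun A g ->
  {ae m, forall x, A x -> f x <= g x} ->
  \int[m]_(x in A) f x <= \int[m]_(x in A) g x.
Proof.
move=> mA mf mg fg; rewrite integralE [leRHS]integralE; apply: leeB.
- apply: ae_ge0_le_integral => //; try exact: measurable_funepos.
  apply: filterS fg => x fg Ax; rewrite !funeposE.
  by apply: le_max2 => //; exact: fg.
- apply: ae_ge0_le_integral => //; try exact: measurable_funeneg.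
  apply: filterS fg => x fg Ax; rewrite !funenegE.
  by apply: le_max2 => //; rewrite leeN2; exact: fg.
Qed.

Section delays.
Context {R : realType} {dS d : measure_display} {S : measurableType dS}
  {Omega : measurableType d}.
Variables (X : nat -> Omega -> S).
Hypothesis mX : forall n, (1 <= n)%N -> measurable_fun setT (X n).
Implicit Types (tau : Omega -> \bar R) (P : nat -> probability Omega R).

Let delay_lb tau nu w : stopping_time X tau ->
  (- nu%:R)%:E <= tau w - nu%:R%:E.
Proof.
move=> st; rewrite EFinN leeDr//.
by have [->|[m ->]] := st.1 w; rewrite ?leey// lee_fin.
Qed.

Lemma measurable_delay tau nu : stopping_time X tau ->
  measurable_fun setT (fun w => tau w - nu%:R%:E).
Proof.
by move=> st; apply: emeasurable_funB => //; exact: (measurable_stopping_time mX st).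
Qed.

Let condexp_delay (Q : probability Omega R) tau nu : stopping_time X tau ->
  is_condexp Q (history X nu.-1) (fun w => tau w - nu%:R%:E)
    (condexp Q (history X nu.-1) (fun w => tau w - nu%:R%:E)).
Proof.
move=> st; apply: (@condexpP _ _ _ _ _ _ (- nu%:R)).
- exact: history_sigma.
- exact: history_measurable.
- exact: measurable_delay.
- by move=> w; exact: delay_lb.
Qed.

(** The event {tau >= nu} belongs to the past before nu, so the delay
    conditional on it is an average of the conditional expectation given that
    past, and an average is at most the essential supremum. *)
Lemma pollak_le_lorden P tau : stopping_time X tau ->
  pollak_delay P tau <= lorden_delay X P tau.
Proof.
move=> st; apply: ub_ereal_sup => _ [nu [nu1 PA] <-].
apply: (@le_trans _ _ (ess_sup (P nu) (condexp (P nu) (history X nu.-1)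
  (fun w => tau w - nu%:R%:E)))); last by apply: ereal_sup_ubound; exists nu.
set Z := condexp _ _ _.
set A := [set w | nu%:R%:E <= tau w] in PA *.
have hA : history X nu.-1 A.
  by rewrite /A -[in Z in Z%:R](prednK nu1); exact: history_not_before.
have mA := history_measurable mX hA.
have [hZ EZ] := condexp_delay (P nu) nu st.
have mZ : measurable_fun setT Z.
  by apply: (history_measurable_fun mX (n := nu.-1)); exact/sub_measurableP.
have ratio0 : 0 <= condexp_event (P nu) A (fun w => tau w - nu%:R%:E).
  rewrite /condexp_event; apply: mule_ge0; last by rewrite inve_ge0.
  by apply: integral_ge0 => w Aw; rewrite sube_ge0.
have ratio (r : R) : (\forall w \ae P nu, Z w <= r%:E) ->
    condexp_event (P nu) A (fun w => tau w - nu%:R%:E) <= r%:E.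
  move=> Zr; have PAf : P nu A \is a fin_num by exact: fin_num_measure.
  have [a a0 PAa] : exists2 a : R, (0 < a)%R & P nu A = a%:E.
    exists (fine (P nu A)); last by rewrite fineK.
    by rewrite fine_gt0// PA ltey_eq PAf.
  rewrite /condexp_event -EZ// PAa inver gt_eqF// lee_pdivrMr// -PAa.
  rewrite -integral_cst//; apply: ae_le_integral_measurable => //.
  - exact: measurable_funTS.
  - by apply: filterS Zr.
apply: le_ereal_inf_tmp => -[r|_|] /=.
- exact: ratio.
- exact: leey.
- move=> Zy; have Zr : \forall w \ae P nu, Z w <= (-1)%:E.
    by apply: filterS Zy => w; rewrite leeNy_eq => /eqP ->; rewrite leNye.
  by have := le_trans ratio0 (ratio _ Zr); rewrite lee_fin ler0N1.
Qed.

(** An essential supremum of a conditional expectation is bounded by testing the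
    delay on every event of the past: the event where the bound fails by 1/n is
    such an event, hence null. *)
Lemma lorden_le P tau (K : R) : stopping_time X tau ->
  (forall nu A, (1 <= nu)%N -> history X nu.-1 A ->
    \int[P nu]_(w in A) (tau w - nu%:R%:E) <= K%:E * P nu A) ->
  lorden_delay X P tau <= K%:E.
Proof.
move=> st HK; apply: ub_ereal_sup => _ [nu nu1 <-].
set Z := condexp _ _ _; apply/ess_supP.
have [hZ EZ] := condexp_delay (P nu) nu st.
have mZ' := (sub_measurableP _ _ _).1 hZ.
have mZ : measurable_fun setT Z by exact: (history_measurable_fun mX mZ').
suff H n : \forall w \ae P nu, Z w < (K + n.+1%:R^-1)%:E.
  apply: filterS (ae_foralln H) => w Hw.
  rewrite leNgt; apply/negP => KZ.
  have [n] : exists n : nat, (K + n.+1%:R^-1)%:E <= Z w.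
    move: KZ; case: (Z w) => [z||//]; last by exists 0%N; rewrite leey.
    rewrite lte_fin => Kz; exists (Num.truncn (z - K)^-1).
    rewrite lee_fin -lerBrDl invf_ple ?posrE ?subr_gt0//.
    by apply: ltW; rewrite truncnS_gt.
  by rewrite leNgt Hw.
pose A := [set w | (K + n.+1%:R^-1)%:E <= Z w].
have hA : history X nu.-1 A.
  rewrite -measurable_historyE -[A]setTI.
  by apply: emeasurable_fun_c_infty => //; exact: mZ'.
have mA := history_measurable mX hA.
exists A; split => //; last by move=> w /= /negP; rewrite -leNgt.
have PAf : P nu A \is a fin_num by exact: fin_num_measure.
have : (K + n.+1%:R^-1)%:E * P nu A <= K%:E * P nu A.
  apply: le_trans (HK nu A nu1 hA); rewrite -EZ// -integral_cst//.
  apply: ae_le_integral_measurable => //; first exact: measurable_funTS.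
  exact: nearW.
have : 0 <= P nu A by [].
move: PAf; case: (P nu A) => // r _; rewrite -!EFinM !lee_fin => r0.
rewrite mulrDl gerDl => h; congr EFin; apply/eqP; rewrite eq_le r0 andbT.
by rewrite -(pmulr_rle0 _ (_ : 0 < n.+1%:R^-1 :> R)%R)// invr_gt0.
Qed.

End delays.

(** * The two procedures as first passage times *)

Section first_passage.
Context {R : realType} {dS d : measure_display} {S : measurableType dS}
  {Omega : measurableType d}.
Variable X : nat -> Omega -> S.
Implicit Types (Y : nat -> Omega -> \bar R) (c : \bar R).

Variant first_passage_spec Y c w : \bar R -> Type :=
| NoPassage of (forall k, (1 <= k)%N -> Y k w < c) :
    first_passage_spec Y c w +oo
| FirstPassage n of (1 <= n)%N & c <= Y n w &
    (forall k, (1 <= k < n)%N -> Y k w < c) :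
    first_passage_spec Y c w n%:R%:E.

Lemma first_passageP Y c w : first_passage_spec Y c w (first_passage Y c w).
Proof.
rewrite /first_passage; set N := [set n | _].
have [N0|] := pselect (exists n, (1 <= n)%N && (c <= Y n w)); last first.
  move=> hN; rewrite (_ : N = set0) ?image_set0 ?ereal_inf0.
    constructor => k k1; rewrite ltNge; apply/negP => ck.
    by apply: hN; exists k; rewrite k1.
  by apply/seteqP; split => // n [/= n1 cn]; apply: hN; exists n; rewrite n1.
case: (ex_minnP N0) => n /andP[n1 cn] minn.
suff -> : ereal_inf [set n%:R%:E | n in N] = n%:R%:E :> \bar R.
  constructor => // k /andP[k1 kn]; rewrite ltNge; apply/negP => ck.
  by have := minn k; rewrite k1 ck => /(_ isT); rewrite leqNgt kn.
apply/eqP; rewrite eq_le; apply/andP; split.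
  by apply: ereal_inf_lbound; exists n.
apply: le_ereal_inf_tmp => _ [k [k1 ck] <-]; rewrite lee_fin ler_nat.
by apply: minn; rewrite k1 ck.
Qed.

Lemma first_passage_stopping Y c :
  (forall n, (1 <= n)%N ->
    measurable_fun setT (Y n : history_type X n -> \bar R)) ->
  stopping_time X (first_passage Y c).
Proof.
move=> mY; split=> [w|n].
  by case: first_passageP => [_|n _ _ _]; [left|right; exists n].
rewrite (_ : [set w | _] = \bigcup_(k in [set k | (1 <= k <= n)%N])
    [set w | c <= Y k w]).
  rewrite -measurable_historyE; apply: bigcup_measurable => k /andP[k1 kn].
  rewrite measurable_historyE; apply: (history_mono kn).
  rewrite -measurable_historyE -[Z in measurable Z]setTI.
  by apply: emeasurable_fun_c_infty => //; exact: mY.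
apply/seteqP; split=> w /=.
  case: first_passageP => [_|k k1 ck _]; first by rewrite leye_eq.
  by rewrite lee_fin ler_nat => kn; exists k => //=; rewrite k1.
move=> [k /= /andP[k1 kn] ck]; case: first_passageP => [|m m1 _ hm].
  by move=> /(_ k k1); rewrite ltNge ck.
rewrite lee_fin ler_nat; rewrite leqNgt; apply/negP => nm.
have := hm k; rewrite k1 (leq_ltn_trans kn nm) => /(_ isT).
by rewrite ltNge ck.
Qed.

Lemma first_passage_not_before Y c n w :
  not_before (first_passage Y c) n.+1 w ->
  forall k, (1 <= k <= n)%N -> Y k w < c.
Proof.
rewrite /not_before /=; case: first_passageP => [h _ k /andP[k1 _]|m _ _ h].
  exact: h.
rewrite lee_fin ler_nat => nm k /andP[k1 kn]; apply: h.
by rewrite k1 (leq_ltn_trans kn).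
Qed.

Lemma first_passage_le Y Y' c c' w :
  (forall n, (1 <= n)%N -> c' <= Y' n w -> c <= Y n w) ->
  first_passage Y c w <= first_passage Y' c' w.
Proof.
move=> h; apply: ereal_inf_le_tmp => _ [n [n1 cn] <-].
by exists n => //; split => //; exact: h.
Qed.

End first_passage.

Lemma bigmaxe_ge {R : realType} (I : eqType) (r : seq I) (F : I -> \bar R) c :
  -oo < c -> c <= \big[maxe/-oo]_(i <- r) F i -> exists2 i, i \in r & c <= F i.
Proof.
move=> c0; elim: r => [|i r IH]; first by rewrite big_nil leeNy_eq gt_eqF.
rewrite big_cons le_max => /orP[ci|/IH[j jr cj]].
  by exists i => //; rewrite mem_head.
by exists j => //; rewrite inE jr orbT.
Qed.

Lemma bigmaxe_lt {R : realType} (I : eqType) (r : seq I) (F : I -> \bar R) c i :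
  \big[maxe/-oo]_(i <- r) F i < c -> i \in r -> F i < c.
Proof.
elim: r => // j r IH; rewrite big_cons gt_max inE => /andP[jc rc] /orP[/eqP ->//|].
exact: IH.
Qed.

Lemma expeR_sum {R : realType} (I : Type) (r : seq I) (F : I -> \bar R) :
  expeR (\sum_(i <- r) F i) = \prod_(i <- r) expeR (F i).
Proof.
elim: r => [|i r IH]; first by rewrite !big_nil expeR0.
by rewrite !big_cons expeRD IH.
Qed.

Lemma measurable_bigmaxe {R : realType} (d' : measure_display) (T : measurableType d')
    (I : eqType) (r : seq I) (F : I -> T -> \bar R) :
  (forall i, i \in r -> measurable_fun setT (F i)) ->
  measurable_fun setT (fun w => \big[maxe/-oo]_(i <- r) F i w).
Proof.
elim: r => [|i r IH] mF; first by under eq_fun do rewrite big_nil; exact: measurable_cst.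
under eq_fun do rewrite big_cons.
apply: measurable_maxe; first by apply: mF; rewrite mem_head.
by apply: IH => j jr; apply: mF; rewrite inE jr orbT.
Qed.

Lemma measurable_esum_seq {R : realType} (d' : measure_display) (T : measurableType d')
    (I : eqType) (r : seq I) (F : I -> T -> \bar R) :
  (forall i, i \in r -> measurable_fun setT (F i)) ->
  measurable_fun setT (fun w => \sum_(i <- r) F i w).
Proof.
elim: r => [|i r IH] mF; first by under eq_fun do rewrite big_nil; exact: measurable_cst.
under eq_fun do rewrite big_cons.
apply: emeasurable_funD; first by apply: mF; rewrite mem_head.
by apply: IH => j jr; apply: mF; rewrite inE jr orbT.
Qed.

Section statistics.
Context {R : realType} {dS d : measure_display} {S : measurableType dS}
  {Omega : measurableType d}.
Variables (X : nat -> Omega -> S) (mu : {measure set S -> \bar R}).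
Variables (M : nat) (f : nat -> S -> R) (g : 'I_M -> nat -> S -> R).
Hypothesis mX : forall n, (1 <= n)%N -> measurable_fun setT (X n).
Hypothesis fd : forall n, (1 <= n)%N -> is_density mu (f n).
Hypothesis gd : forall l n, (1 <= n)%N -> is_density mu (g l n).

Local Notation LR l i w := (lratio (g l i) (f i) (X i w)).

Let LR0 l i w : (1 <= i)%N -> 0 <= LR l i w.
Proof. by move=> i1; apply: (lratio_ge0 (mu := mu)); [exact: gd|exact: fd]. Qed.

Let prodLR0 l k n w : (1 <= k)%N -> 0 <= \prod_(k <= i < n) LR l i w.
Proof.
move=> k1; rewrite big_seq; apply: prode_ge0 => i.
by rewrite mem_index_iota => /andP[ki _]; apply: LR0; exact: leq_trans ki.
Qed.

(** The Shiryaev-Roberts statistic of a single hypothesis. *)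
Definition sr_stat (l : 'I_M) (n : nat) (w : Omega) : \bar R :=
  \sum_(1 <= k < n.+1) \prod_(k <= i < n.+1) LR l i w.

Lemma R_stat_sum n w : R_stat X f g n w = \sum_(l < M) sr_stat l n w.
Proof. by []. Qed.

Lemma sr_stat_ge0 l n w : 0 <= sr_stat l n w.
Proof.
rewrite /sr_stat big_seq; apply: sume_ge0 => k; rewrite mem_index_iota => /andP[k1 _].
exact: prodLR0.
Qed.

Lemma R_stat_ge0 n w : 0 <= R_stat X f g n w.
Proof. by apply: sume_ge0 => l _; exact: sr_stat_ge0. Qed.

(** Multiplying by the new ratio extends every product, and the 1 accounts for
    the product that starts at the new observation. *)
Lemma sr_statS l n w : sr_stat l n.+1 w = (sr_stat l n w + 1) * LR l n.+1 w.
Proof.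
rewrite /sr_stat big_nat_recr//= big_nat1 ge0_muleDl ?mul1e//; last first.
  exact: sr_stat_ge0.
congr (_ + _); rewrite big_seq [in RHS]big_seq ge0_sume_distrl; last first.
  by move=> k; rewrite mem_index_iota => /andP[k1 _]; exact: prodLR0.
apply: eq_bigr => k; rewrite mem_index_iota => /andP[k1 kn].
by rewrite [LHS]big_nat_recr//=; exact: ltnW.
Qed.

Lemma measurable_history_LR l i n : (1 <= i <= n)%N ->
  measurable_fun setT ((fun w => LR l i w) : history_type X n -> \bar R).
Proof.
move=> i1n; have /andP[i1 _] := i1n.
apply: (@measurableT_comp _ _ _ _ _ _ (lratio (g l i) (f i)) _
  (X i : history_type X n -> S)).
  by apply: (measurable_lratio (mu := mu)); [exact: gd|exact: fd].
exact: measurable_history_obs.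
Qed.

Lemma measurable_history_le m n (Y : Omega -> \bar R) : (m <= n)%N ->
  measurable_fun setT (Y : history_type X m -> \bar R) ->
  measurable_fun setT (Y : history_type X n -> \bar R).
Proof.
move=> mn mY; apply/sub_measurableP => B mB.
by apply: (history_mono mn); move/sub_measurableP: mY; exact.
Qed.

Lemma measurable_history_sr_stat l n :
  measurable_fun setT (sr_stat l n : history_type X n -> \bar R).
Proof.
elim: n => [|n IH].
  rewrite (_ : sr_stat l 0 = cst 0)//.
  by apply/funext => w; rewrite /sr_stat big_geq.
rewrite (_ : sr_stat l n.+1 = fun w => (sr_stat l n w + 1) * LR l n.+1 w); last first.
  by apply/funext => w; rewrite sr_statS.
apply: emeasurable_funM; last by apply: measurable_history_LR; rewrite leqnn.
by apply: emeasurable_funD => //; exact: (measurable_history_le (leqnSn n)).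
Qed.

Lemma measurable_history_R_stat n :
  measurable_fun setT (R_stat X f g n : history_type X n -> \bar R).
Proof.
rewrite (_ : R_stat X f g n = fun w => \sum_(l < M) sr_stat l n w)//.
by apply: emeasurable_sum => l; exact: measurable_history_sr_stat.
Qed.

Lemma measurable_history_W_stat l n :
  measurable_fun setT (W_stat X f g l n : history_type X n -> \bar R).
Proof.
apply: measurable_bigmaxe => k; rewrite mem_index_iota => /andP[k1 _].
apply: measurable_esum_seq => i; rewrite mem_index_iota ltnS => /andP[ki ni].
have i1 : (1 <= i)%N by exact: leq_trans ki.
apply: (@measurableT_comp _ _ _ _ _ _ (fun x => lne (lratio (g l i) (f i) x)) _
  (X i : history_type X n -> S)).
  by apply: (measurable_lne_lratio (mu := mu)); [exact: gd|exact: fd].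
by apply: measurable_history_obs; rewrite i1.
Qed.

Lemma tau_sr_stopping beta : stopping_time X (tau_sr X f g beta).
Proof. by apply: first_passage_stopping => n _; exact: measurable_history_R_stat. Qed.

Lemma tau_cm_stopping beta : stopping_time X (tau_cm X f g beta).
Proof.
apply: first_passage_stopping => n _.
apply: measurable_bigmaxe => l _; exact: measurable_history_W_stat.
Qed.

(** The exponential of a partial sum in the maximum defining W is one of the
    nonnegative terms of R. *)
Lemma tau_sr_le_tau_cm beta w : (0 < beta)%R -> (1 <= M)%N ->
  tau_sr X f g beta w <= tau_cm X f g beta w.
Proof.
move=> b0 M1; apply: first_passage_le => n n1.
have bM : (0 < beta * M%:R)%R by rewrite mulr_gt0// ltr0n.
move=> /(bigmaxe_ge (ltNyr _)) [l _] /(bigmaxe_ge (ltNyr _)) [k].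
rewrite mem_index_iota ltnS => /andP[k1 kn] h.
rewrite R_stat_sum (bigD1 l)//=; apply: le_trans (leeDl _ _); last first.
  by apply: sume_ge0 => l' _; exact: sr_stat_ge0.
rewrite /sr_stat (bigD1_seq k)/= ?mem_index_iota ?k1 ?ltnS ?iota_uniq//.
apply: le_trans (leeDl _ _); last first.
  rewrite big_seq_cond; apply: sume_ge0 => k'; rewrite mem_index_iota => /andP[/andP[k'1 _] _].
  exact: prodLR0.
move: h; rewrite -lee_expeR /= lnK// expeR_sum.
rewrite [in Z in _ <= Z -> _]big_seq [in Z in _ -> _ <= Z]big_seq => /le_trans; apply.
rewrite le_eqVlt; apply/orP; left; apply/eqP; apply: eq_bigr => i.
rewrite mem_index_iota => /andP[ki _]; rewrite lneK// in_itv/= leey andbT.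
by apply: LR0; exact: leq_trans ki.
Qed.

Lemma tau_cm_not_before beta n w : not_before (tau_cm X f g beta) n.+1 w ->
  forall l k m, (1 <= k <= m)%N -> (m <= n)%N ->
  \sum_(k <= i < m.+1) lne (LR l i w) < (ln (beta * M%:R))%:E.
Proof.
move=> /first_passage_not_before h l k m /andP[k1 km] mn.
have m1 : (1 <= m)%N by exact: leq_trans km.
have := h m; rewrite m1 mn => /(_ isT)/bigmaxe_lt /(_ (mem_index_enum l)).
by move=> /bigmaxe_lt; apply; rewrite mem_index_iota k1 ltnS.
Qed.

End statistics.

(** * The Shiryaev-Roberts martingale and the false alarm bound *)

Section martingale_part.
Context {R : realType} {dS d : measure_display} {S : measurableType dS}
  {Omega : measurableType d}.
Variables (X : nat -> Omega -> S) (mu : {measure set S -> \bar R}).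
Variables (M : nat) (f : nat -> S -> R) (g : 'I_M -> nat -> S -> R).
Variable P : probability Omega R.
Hypothesis mX : forall n, (1 <= n)%N -> measurable_fun setT (X n).
Hypothesis fd : forall n, (1 <= n)%N -> is_density mu (f n).
Hypothesis gd : forall l n, (1 <= n)%N -> is_density mu (g l n).
Hypothesis KLfin : forall l n, (1 <= n)%N -> KL mu (g l n) (f n) < +oo.
Hypothesis law : has_law X mu P f.

Local Notation Rn := (R_stat X f g).

Let mR n : measurable_fun setT (Rn n).
Proof.
by apply: (history_measurable_fun mX (n := n)); exact: (measurable_history_R_stat fd gd).
Qed.

Let R0 n w : 0 <= Rn n w.
Proof. exact: (R_stat_ge0 X fd gd). Qed.

(** The martingale property in integrated form: the new ratio has mean 1 and is
    independent of the past, so each of the M hypotheses adds P A. *)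
Lemma integral_R_statS n A : history X n A ->
  \int[P]_(w in A) Rn n.+1 w = \int[P]_(w in A) Rn n w + M%:R%:E * P A.
Proof.
move=> hA; have mA := history_measurable mX hA.
have msrk l k : measurable_fun setT (sr_stat X f g l k).
  by apply: (history_measurable_fun mX (n := k)); exact: (measurable_history_sr_stat fd gd).
have sr0 l k w : 0 <= sr_stat X f g l k w by exact: (sr_stat_ge0 X fd gd).
have step l : \int[P]_(w in A) sr_stat X f g l n.+1 w =
    \int[P]_(w in A) sr_stat X f g l n w + P A.
  transitivity (\int[P]_w (((sr_stat X f g l n w + 1) * (\1_A w)%:E) *
      lratio (g l n.+1) (f n.+1) (X n.+1 w))).
    rewrite integral_mkcond epatch_indic; apply: eq_integral => w _.
    by rewrite (sr_statS X fd gd) muleAC.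
  rewrite (integral_history_obs mX fd law
    (u := fun w => (sr_stat X f g l n w + 1) * (\1_A w)%:E)
    (k := lratio (g l n.+1) (f n.+1))).
  - rewrite (integral_lratio (gd l (ltn0Sn n)) (fd (ltn0Sn n))) ?mule1//; last exact: KLfin.
    rewrite -(epatch_indic _ A) -integral_mkcond ge0_integralD//.
    + by rewrite probability_integral1.
    + by apply: measurable_funTS; exact: msrk.
  - apply: emeasurable_funM.
      by apply: emeasurable_funD => //; exact: (measurable_history_sr_stat fd gd).
    by apply/measurable_EFinP; exact: measurable_indic.
  - by move=> w; rewrite mule_ge0 ?lee_fin// adde_ge0.
  - exact: (measurable_lratio (gd l (ltn0Sn n)) (fd (ltn0Sn n))).
  - exact: (lratio_ge0 (gd l (ltn0Sn n)) (fd (ltn0Sn n))).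
have intR k : \int[P]_(w in A) Rn k w = \sum_(l < M) \int[P]_(w in A) sr_stat X f g l k w.
  by rewrite -ge0_integral_sum// => l; exact: measurable_funTS.
rewrite !intR.
rewrite (eq_bigr (fun l => \int[P]_(w in A) sr_stat X f g l n w + P A)) => [|l _]; last first.
  exact: step.
rewrite big_split/=; congr (_ + _).
have PAf : P A \is a fin_num by exact: fin_num_measure.
by rewrite -(fineK PAf) sumEFin sumr_const card_ord -EFinM mulr_natl.
Qed.

Lemma integral_R_stat n : \int[P]_w Rn n w = (n * M)%:R%:E.
Proof.
elim: n => [|n IH].
  rewrite integral0_eq// => w _; rewrite /R_stat big1// => l _.
  by rewrite big_geq.
rewrite integral_R_statS; last exact: history_setT.
by rewrite IH probability_setT mule1 -EFinD -natrD mulSn addnC.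
Qed.

Lemma integrable_R_stat n : P.-integrable setT (Rn n).
Proof.
apply/integrableP; split => //.
rewrite (eq_integral (Rn n)) ?integral_R_stat ?ltry// => w _.
by rewrite gee0_abs.
Qed.

Lemma R_stat_martingale :
  martingale P (history X) (fun n w => Rn n w - (n * M)%:R%:E).
Proof.
move=> n.
have sub : sub_measurable (history X n) (fun w => Rn n w - (n * M)%:R%:E).
  apply/sub_measurableP; apply: emeasurable_funB => //.
  exact: (measurable_history_R_stat fd gd).
have icst A c : measurable A -> P.-integrable A (cst c%:E).
  exact: finite_measure_integrable_cst.
split => //.
  by apply: integrableB => //; [exact: integrable_R_stat|exact: icst].
split => // A hA; have mA := history_measurable mX hA.
have iA k : P.-integrable A (Rn k) by apply: integrableS (integrable_R_stat k).
have intE k : \int[P]_(w in A) (Rn k w - (k * M)%:R%:E) =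
    \int[P]_(w in A) Rn k w - (k * M)%:R%:E * P A.
  rewrite (integralB mA (iA k) (icst A (k * M)%:R mA)).
  by rewrite integral_cst.
rewrite !intE integral_R_statS//.
have := integrable_fin_num mA (iA n).
have : P A \is a fin_num by exact: fin_num_measure.
case: (P A) => // a _; case: (\int[P]_(w in A) Rn n w) => // r _.
rewrite -!EFinM -!EFinB; congr EFin; rewrite mulSn natrD; lra.
Qed.

(** Optional stopping done by hand with the integral of R_n over {tau > n},
    which needs no integrability of the stopped statistic: if the mean m of tau
    is finite, n P(tau > n) <= m, so that P(tau > n) vanishes. *)
Lemma tau_sr_mean_ge beta : (0 < beta)%R -> (1 <= M)%N ->
  beta%:E <= \int[P]_w tau_sr X f g beta w.
Proof.
move=> b0 M1; set tau := tau_sr X f g beta.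
have st : stopping_time X tau by exact: (tau_sr_stopping X fd gd).
have mN i := measurable_not_before mX i st.
have Mp : (0 < M%:R :> R)%R by rewrite ltr0n.
pose p i := fine (P (not_before tau i)).
have pE i : P (not_before tau i) = (p i)%:E by rewrite fineK// fin_num_measure.
have p0 i : (0 <= p i)%R by rewrite fine_ge0.
(* On {tau = n + 1} the statistic has reached beta M. *)
have step n : (beta * M%:R)%:E * ((p n.+1)%:E - (p n.+2)%:E) +
    \int[P]_(w in not_before tau n.+2) Rn n.+1 w <=
    \int[P]_(w in not_before tau n.+1) Rn n w + M%:R%:E * (p n.+1)%:E.
  rewrite -[in leRHS]pE -integral_R_statS; last exact: history_not_before.
  have sub := @not_before_mono _ _ _ tau _ _ (leqnSn n.+1).
  have mD : measurable (not_before tau n.+1 `\` not_before tau n.+2).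
    exact: measurableD.
  rewrite -[in leRHS](setDUK sub) setUC ge0_integral_setU//; last 2 first.
  - exact: measurable_funTS.
  - by apply/disj_set2P; rewrite setDKI.
  apply: leeD => //.
  have -> : (p n.+1)%:E - (p n.+2)%:E =
      P (not_before tau n.+1 `\` not_before tau n.+2).
    rewrite measureD//; last by rewrite -[ltLHS]/(P _) pE ltry.
    by rewrite (setIidr sub) -!pE.
  rewrite -integral_cst//; apply: ge0_le_integral => //.
  - by move=> w _; rewrite /= lee_fin mulr_ge0// ltW.
  - exact: measurable_funTS.
  move=> w [] /=; rewrite /not_before /= /tau /tau_sr.
  case: first_passageP => [_|m m1 hm _]; first by rewrite !leey => _ [].
  rewrite !lee_fin !ler_nat => nm /negP; rewrite -ltnNge ltnS => mn.
  by have -> : n.+1 = m by apply/eqP; rewrite eqn_leq nm.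
have sum n : ((beta * M%:R) * (p 1%N - p n.+1))%:E +
    \int[P]_(w in not_before tau n.+1) Rn n w <=
    (M%:R * \sum_(1 <= i < n.+1) p i)%:E.
  elim: n => [|n IH].
    rewrite subrr mulr0 big_geq// mulr0 add0e integral0_eq// => w _.
    by rewrite /R_stat big1// => l _; rewrite big_geq.
  rewrite big_nat_recr//=.
  have fin k : \int[P]_(w in not_before tau k.+1) Rn k w \is a fin_num.
    apply: integrable_fin_num => //; exact: integrableS (integrable_R_stat k).
  move: (step n) IH (fin n) (fin n.+1).
  case: (\int[P]_(w in not_before tau n.+1) _) => // r.
  case: (\int[P]_(w in not_before tau n.+2) _) => // s.
  rewrite -!EFinB -!EFinM -!EFinD !lee_fin => h1 h2 _ _; lra.
have p1 : p 1%N = 1%R.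
  rewrite /p (_ : not_before tau 1 = setT) ?probability_setT//.
  apply/seteqP; split => // w _; rewrite /not_before /= /tau /tau_sr.
  by case: first_passageP => [_|m m1 _ _]; rewrite ?leey// lee_fin ler_nat.
have meanE : \int[P]_w tau w = \sum_(k <oo) (p k.+1)%:E.
  have := integral_excess mX P 0%N st measurableT.
  under eq_integral => w _.
    rewrite sube0 (max_idPl _); last first.
      by have [->|[m ->]] := st.1 w; rewrite ?leey// lee_fin.
    over.
  move=> ->; apply: eq_eseriesr => k _.
  by rewrite add0n setTI -pE.
have partial n : (\sum_(1 <= i < n.+1) p i)%:E <= \int[P]_w tau w.
  rewrite meanE -sumEFin big_add1/=.
  by apply: nneseries_lim_ge => i _; rewrite lee_fin.
have main n : (beta * (1 - p n.+1))%:E <= \int[P]_w tau w.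
  apply: le_trans (partial n); rewrite lee_fin.
  have : 0 <= \int[P]_(w in not_before tau n.+1) Rn n w by exact: integral_ge0.
  have := sum n; rewrite p1 => h1 h2.
  rewrite -(ler_pM2l Mp) -lee_fin; apply: le_trans h1.
  by rewrite mulrA [(M%:R * beta)%R]mulrC leeDl.
(* The probabilities p decrease, so n terms of the mean are at least n p_(n+1). *)
have np n : (n%:R * p n.+1)%:E <= \int[P]_w tau w.
  apply: le_trans (partial n); rewrite lee_fin.
  have -> : (n%:R * p n.+1 = \sum_(1 <= i < n.+1) p n.+1)%R.
    by rewrite sumr_const_nat subn1 mulr_natl.
  rewrite !big_seq; apply: ler_sum => i; rewrite mem_index_iota ltnS => /andP[_ ni].
  rewrite /p fine_le ?fin_num_measure// le_measure ?inE//.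
  by apply: not_before_mono; exact: leqW.
have tau0 : 0 <= \int[P]_w tau w.
  by apply: integral_ge0 => w _; have [->|[m ->]] := st.1 w; rewrite ?leey// lee_fin.
move: tau0 main np; case: (\int[P]_w tau w) => [m|_ _ _|//]; last exact: leey.
rewrite !lee_fin => m0 main np; rewrite leNgt; apply/negP => mb.
(* If m < beta, the bounds beta (1 - p) <= m and n p <= m on p = p_(n+1)
   contradict each other once n (beta - m) > beta m. *)
pose n := (Num.truncn (beta * m / (beta - m))).+1.
have bm : (0 < beta - m)%R by rewrite subr_gt0.
have : (beta * m / (beta - m) < n%:R)%R by exact: truncnS_gt.
rewrite ltr_pdivrMr// => h.
have := main n; have := np n; rewrite !lee_fin => h1 h2.
have n0 : (0 <= n%:R :> R)%R by [].
have h3 := ler_wpM2l n0 h2; have h4 := ler_wpM2l (ltW b0) h1.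
nra.
Qed.

End martingale_part.

(** * The delay of the cumulative sum procedure *)

Lemma cvg_sum_seq {R : realType} (U : Type) (F : set_system U) (FF : Filter F)
    (I : eqType) (r : seq I) (u : I -> U -> R) (v : I -> R) :
  (forall i, i \in r -> u i n @[n --> F] --> v i) ->
  (\sum_(i <- r) u i n)%R @[n --> F] --> (\sum_(i <- r) v i)%R.
Proof.
elim: r => [|i r IH] uv.
  by under eq_fun do rewrite big_nil; rewrite big_nil; exact: cvg_cst.
under eq_fun do rewrite big_cons; rewrite big_cons.
apply: cvgD; first by apply: uv; rewrite mem_head.
by apply: IH => j jr; apply: uv; rewrite inE jr orbT.
Qed.

Section post_change.
Context {R : realType} {dS d : measure_display} {S : measurableType dS}
  {Omega : measurableType d}.
Variables (X : nat -> Omega -> S) (mu : {measure set S -> \bar R}).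
Variables (f g : nat -> S -> R) (T : nat).
Hypothesis T1 : (1 <= T)%N.
Hypothesis mX : forall n, (1 <= n)%N -> measurable_fun setT (X n).
Hypothesis fd : forall n, (1 <= n)%N -> is_density mu (f n).
Hypothesis gd : forall n, (1 <= n)%N -> is_density mu (g n).
Hypothesis fper : seq_periodic T f.
Hypothesis gper : seq_periodic T g.
Hypothesis KLfin : forall n, (1 <= n)%N -> KL mu (g n) (f n) < +oo.

Lemma change_density_is_density nu n : (1 <= n)%N ->
  is_density mu (change_density f g nu n).
Proof. by move=> n1; rewrite /change_density; case: ifP => _; [exact: fd|exact: gd]. Qed.

(** Capping the increments bounds the overshoot of the walk over its threshold,
    which a finite divergence alone does not bound. *)
Definition capped_llr (b : R) (i : nat) (x : S) : R :=
  Num.min (llr (g i) (f i) x) b.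

Definition capped_mean (b : R) (i : nat) : R :=
  fine (\int[mu]_x (capped_llr b i x * g i x)%:E).

Definition KL_num (i : nat) : R := fine (KL mu (g i) (f i)).

Lemma measurable_capped_llr b i : (1 <= i)%N ->
  measurable_fun setT (capped_llr b i).
Proof.
by move=> i1; apply: measurable_minr => //; exact: (measurable_llr (gd i1) (fd i1)).
Qed.

Lemma capped_llr_norm b i x : (0 <= b)%R ->
  (`|capped_llr b i x| <= `|llr (g i) (f i) x|)%R.
Proof.
move=> b0; rewrite /capped_llr; have [//|bz] := leP (llr (g i) (f i) x) b.
by rewrite ger0_norm// ger0_norm ?ltW// (le_lt_trans b0).
Qed.

Lemma integrable_capped_llr b i : (0 <= b)%R -> (1 <= i)%N ->
  mu.-integrable setT (fun x => (capped_llr b i x * g i x)%:E).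
Proof.
move=> b0 i1; have [mg g0 _] := gd i1.
apply: le_integrable (integrable_llr (gd i1) (fd i1) (KLfin i1)) => //.
  apply/measurable_EFinP; apply: measurable_funM => //.
  exact: measurable_capped_llr.
move=> x _; rewrite /= lee_fin !normrM ler_wpM2r//.
exact: capped_llr_norm.
Qed.

Lemma capped_meanE b i : (0 <= b)%R -> (1 <= i)%N ->
  \int[mu]_x (capped_llr b i x * g i x)%:E = (capped_mean b i)%:E.
Proof.
move=> b0 i1; rewrite fineK//; apply: integrable_fin_num => //.
exact: integrable_capped_llr.
Qed.

Lemma capped_mean_cvg i : (1 <= i)%N ->
  capped_mean n%:R i @[n --> \oo] --> KL_num i.
Proof.
move=> i1; have [mg g0 _] := gd i1.
have iz := integrable_llr (gd i1) (fd i1) (KLfin i1).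
apply: fine_cvg.
rewrite fineK; last exact: (KL_fin_num (gd i1) (fd i1) (KLfin i1)).
rewrite (KL_llrE (gd i1) (fd i1) (KLfin i1)).
apply: (@dominated_cvg _ _ _ mu setT measurableT
  (fun (n : nat) x => (capped_llr n%:R i x * g i x)%:E) _
  (fun x => `|(llr (g i) (f i) x * g i x)%:E|)) => //.
- move=> n; apply/measurable_EFinP; apply: measurable_funM => //.
  exact: measurable_capped_llr.
- move=> x _; apply: cvg_near_cst; near=> n.
  rewrite /capped_llr min_l//; near: n; exact: nbhs_infty_ger.
- exact: integrable_abse.
- move=> n x _; rewrite /= lee_fin !normrM ler_wpM2r//.
  exact: capped_llr_norm.
Unshelve. all: by end_near. Qed.

Lemma information_mean : (fine (information mu T g f) = period_mean T KL_num)%R.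
Proof.
rewrite /information /period_mean big_seq (eq_bigr (fun i => (KL_num i)%:E)).
  by rewrite -big_seq sumEFin -EFinM.
move=> i; rewrite mem_index_iota => /andP[i1 _].
by rewrite fineK//; exact: (KL_fin_num (gd i1) (fd i1) (KLfin i1)).
Qed.

Lemma capped_period_mean_cvg :
  period_mean T (capped_mean n%:R) @[n --> \oo] --> period_mean T KL_num.
Proof.
rewrite /period_mean; apply: cvgMr.
apply: cvg_sum_seq => i; rewrite mem_index_iota => /andP[i1 _].
exact: capped_mean_cvg.
Qed.

Lemma capped_mean_periodic b i : (1 <= i)%N -> capped_mean b (i + T) = capped_mean b i.
Proof. by move=> i1; rewrite /capped_mean /capped_llr (fper i1) (gper i1). Qed.

Lemma KL_num_periodic i : (1 <= i)%N -> KL_num (i + T) = KL_num i.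
Proof. by move=> i1; rewrite /KL_num (fper i1) (gper i1). Qed.

Variables (m : nat) (P : probability Omega R).
Hypothesis law : has_law X mu P (change_density f g m.+1).

Let after i : (m < i)%N -> change_density f g m.+1 i = g i.
Proof. by move=> mi; rewrite /change_density ltnNge mi. Qed.

(** After the change almost surely no density vanishes at its observation, so
    the extended and the real log-likelihood ratios agree along the path. *)
Lemma support_ae : {ae P, forall w, forall i, (m < i)%N ->
  g i (X i w) != 0%R /\ f i (X i w) != 0%R}.
Proof.
apply: ae_foralln => i; have [im|mi] := leqP i m.
  exact: aeW.
have i1 : (1 <= i)%N by exact: leq_ltn_trans mi.
have [mg g0 _] := gd i1; have [mf f0 _] := fd i1.
pose C := [set x | (g i x == 0%R) || (f i x == 0%R)].
have mC : measurable C.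
  rewrite (_ : C = (fun x => (g i x == 0%R) || (f i x == 0%R)) @^-1` [set true]).
    rewrite -[Z in measurable Z]setTI; apply: measurable_or => //.
      exact: measurable_fun_eqr.
    exact: measurable_fun_eqr.
  by apply/seteqP; split => x /=.
exists (X i @^-1` C); split.
- by rewrite -[Z in measurable Z]setTI; exact: mX.
- apply: (eq_trans (law.2 i C i1 mC)); rewrite after//.
  exact: (density_support_null (gd i1) (fd i1) (KLfin i1)).
- move=> w /= h; apply/negPn/negP; rewrite negb_or => /andP[h1 h2].
  by apply: h.
Qed.

(** The Wald identity from the change point on, where the observations have the
    densities g; A is an event of the past before the change. *)
Lemma wald_post_change (y : nat -> S -> R) (a : nat -> R)
    (tau : Omega -> \bar R) A n :
  stopping_time X tau -> history X m A ->
  (forall i, (m < i)%N -> measurable_fun setT (y i)) ->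
  (forall i, (m < i)%N -> mu.-integrable setT (fun x => (y i x * g i x)%:E)) ->
  (forall i, (m < i)%N -> \int[mu]_x (y i x * g i x)%:E = (a i)%:E) ->
  let U w := (\sum_(m.+1 <= i < n.+1)
    y i (X i w) * \1_(not_before tau i) w)%R in
  P.-integrable setT (fun w => (U w)%:E) /\
  \int[P]_(w in A) (U w)%:E =
  \sum_(m.+1 <= i < n.+1) (a i)%:E * P (A `&` not_before tau i).
Proof.
move=> st hA my iy ay; apply: (wald_truncated mX _ law) => //.
- by move=> k k1; exact: change_density_is_density.
- by move=> i mi; rewrite after//; exact: iy.
- by move=> i mi; rewrite after//; exact: ay.
Qed.

End post_change.

Section detection_delay.
Context {R : realType} {dS d : measure_display} {S : measurableType dS}
  {Omega : measurableType d}.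
Variables (X : nat -> Omega -> S) (mu : {measure set S -> \bar R}).
Variables (T M : nat) (f : nat -> S -> R) (g : 'I_M -> nat -> S -> R).
Hypothesis T1 : (1 <= T)%N.
Hypothesis mX : forall n, (1 <= n)%N -> measurable_fun setT (X n).
Hypothesis fd : forall n, (1 <= n)%N -> is_density mu (f n).
Hypothesis gd : forall l n, (1 <= n)%N -> is_density mu (g l n).
Hypothesis fper : seq_periodic T f.
Hypothesis gper : forall l, seq_periodic T (g l).
Hypothesis KLfin : forall l n, (1 <= n)%N -> KL mu (g l n) (f n) < +oo.
Variables (l : 'I_M) (P : nat -> probability Omega R).
Hypothesis law : forall nu, (1 <= nu)%N ->
  has_law X mu (P nu) (change_density f (g l) nu).

(** Before it is stopped the walk is below its threshold, since it is one of the
    sums in the maximum defining W, and the last step adds at most b. *)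
Lemma capped_walk_le (beta b : R) m n w : (0 <= b)%R -> (1 <= beta * M%:R)%R ->
  (m <= n)%N ->
  (forall i, (m < i)%N -> g l i (X i w) != 0%R /\ f i (X i w) != 0%R) ->
  (\sum_(m.+1 <= i < n.+1) capped_llr f (g l) b i (X i w) *
    \1_(not_before (tau_cm X f g beta) i) w <= ln (beta * M%:R) + b)%R.
Proof.
move=> b0 bM mn good; set tau := tau_cm X f g beta; set c := ln _.
have c0 : (0 <= c)%R by exact: ln_ge0.
pose U k := (\sum_(m.+1 <= i < k.+1) capped_llr f (g l) b i (X i w) *
    \1_(not_before tau i) w)%R.
pose W k := (\sum_(m.+1 <= i < k.+1) capped_llr f (g l) b i (X i w))%R.
have Wc k : (m <= k)%N -> not_before tau k.+1 w -> (W k <= c)%R.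
  rewrite leq_eqVlt => /orP[/eqP <- _|mk hk]; first by rewrite /W big_geq.
  have mk1 : (1 <= m.+1 <= k)%N by rewrite mk.
  have := tau_cm_not_before hk l mk1 (leqnn _).
  rewrite big_seq (eq_bigr (fun i => (llr (g l i) (f i) (X i w))%:E)); last first.
    move=> i; rewrite mem_index_iota => /andP[mi _].
    have [gi fi] := good i mi; have i1 : (1 <= i)%N by exact: leq_ltn_trans mi.
    by rewrite (lne_lratioE (gd l i1) (fd i1)) (negbTE gi) (negbTE fi).
  rewrite -big_seq sumEFin lte_fin => h; apply: ltW; apply: le_lt_trans h.
  by apply: ler_sum => i _; rewrite /capped_llr ge_min lexx.
(* The stopped walk U follows the free walk W until tau fires. *)
suff : (not_before tau n.+1 w -> U n = W n) /\ (U n <= c + b)%R by case.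
elim: n mn => [|n IH].
  rewrite leqn0 => /eqP m0; rewrite /U /W !big_geq ?m0//; split => //.
  exact: addr_ge0.
rewrite leq_eqVlt => /orP[/eqP <-|].
  by rewrite /U /W !big_geq//; split => //; exact: addr_ge0.
rewrite ltnS => mn; have [IH1 IH2] := IH mn.
have US : U n.+1 = (U n + capped_llr f (g l) b n.+1 (X n.+1 w) *
    \1_(not_before tau n.+1) w)%R by rewrite /U big_nat_recr.
have WS : W n.+1 = (W n + capped_llr f (g l) b n.+1 (X n.+1 w))%R.
  by rewrite /W big_nat_recr.
have [h|h] := pselect (not_before tau n.+1 w).
  rewrite US indicE mem_set// mulr1 IH1// WS; split => //.
  by apply: lerD; [exact: Wc|rewrite /capped_llr ge_min lexx orbT].
rewrite US indicE memNset// mulr0 addr0; split => // h'.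
by exfalso; apply: h; exact: (not_before_mono (leqnSn n.+1)).
Qed.

(** The integral of the stopped capped walk over an event of the past is at most
    threshold plus cap; by the Wald identity it is also the mean increment times
    the delay, up to the deviation of the periodic means. *)
Lemma lorden_tau_cm_le (beta b : R) : (0 <= b)%R -> (1 <= beta * M%:R)%R ->
  let a := capped_mean mu f (g l) b in
  (0 < period_mean T a)%R ->
  lorden_delay X P (tau_cm X f g beta) <=
  ((ln (beta * M%:R) + b + period_deviation T a) / period_mean T a)%:E.
Proof.
move=> b0 bM a a0; set tau := tau_cm X f g beta.
set c := ln _; set dev := period_deviation T a.
have c0 : (0 <= c)%R by exact: ln_ge0.
have dev0 : (0 <= dev)%R by exact: period_deviation_ge0.
have st : stopping_time X tau by exact: (tau_cm_stopping X fd gd).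
apply: lorden_le => // -[//|m] A _ hA; have mA := history_measurable mX hA.
set Q := P m.+1; have lawQ := law (ltn0Sn m).
have mN i := measurable_not_before mX i st.
pose p i := fine (Q (A `&` not_before tau i)).
have pE i : Q (A `&` not_before tau i) = (p i)%:E.
  by rewrite fineK// fin_num_measure//; exact: measurableI.
have p0 i : (0 <= p i)%R by rewrite fine_ge0.
have QA : Q A = (fine (Q A))%:E by rewrite fineK// fin_num_measure.
set q := fine (Q A) in QA.
have ple i : (p i <= q)%R.
  by rewrite -lee_fin -pE -QA le_measure ?inE//; exact: measurableI.
have pmono i : (0 <= p i.+1 <= p i)%R.
  rewrite p0 -lee_fin -!pE le_measure ?inE//; try exact: measurableI.
  by apply: setIS; exact: not_before_mono.
have sumle n : (\sum_(m.+1 <= i < n.+1) p i <= (c + b + dev) / period_mean T a * q)%R.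
  have [nm|mn] := leqP n m.
    by rewrite big_geq ?ltnS// mulr_ge0// ?divr_ge0 ?addr_ge0// ?fine_ge0// ltW.
  have /= [iU EU] := @wald_post_change _ _ _ _ _ X mu f (g l) mX fd (gd l) m Q lawQ
    (capped_llr f (g l) b) a tau A n st hA
    (fun i mi => measurable_capped_llr fd (gd l) b (leq_ltn_trans (leq0n m) mi))
    (fun i mi => integrable_capped_llr fd (gd l) (KLfin l) b0 (leq_ltn_trans (leq0n m) mi))
    (fun i mi => capped_meanE fd (gd l) (KLfin l) b0 (leq_ltn_trans (leq0n m) mi)).
  have : \int[Q]_(w in A) (\sum_(m.+1 <= i < n.+1) capped_llr f (g l) b i (X i w) *
      \1_(not_before tau i) w)%:E <= (c + b)%:E * Q A.
    rewrite -integral_cst//; apply: ae_le_integral_measurable => //.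
      by apply: measurable_funTS; exact: measurable_int iU.
    have := support_ae mX fd (gd l) (KLfin l) lawQ.
    apply: filterS => w good _; rewrite /= lee_fin.
    by apply: capped_walk_le => //; exact: ltnW.
  rewrite EU (eq_bigr (fun i => (a i * p i)%:E)); last by move=> i _; rewrite pE.
  rewrite sumEFin QA -EFinM lee_fin => h.
  have h2 := @periodic_weighted_sum_ge R T a p m n T1
    (fun i i1 => capped_mean_periodic mu fper (gper l) b i1) (fun i _ => pmono i) (p0 _).
  have h3 : (dev * p m.+1 <= dev * q)%R by rewrite ler_wpM2l.
  rewrite -/dev in h2; rewrite [leRHS]mulrAC ler_pdivlMr// mulrC; lra.
apply: (@le_trans _ _ (\int[Q]_(w in A) maxe (tau w - m.+1%:R%:E) 0)).
  apply: ae_le_integral_measurable => //.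
  - by apply: measurable_funTS; exact: (measurable_delay mX m.+1 st).
  - by apply: measurable_funTS; apply: measurable_maxe => //; exact: (measurable_delay mX m.+1 st).
  - by apply: aeW => w _; rewrite le_max lexx.
rewrite (integral_excess mX Q m.+1 st mA) QA -EFinM.
apply: lime_le.
  by apply: is_cvg_nneseries => k _ _.
apply: nearW => n; rewrite (eq_bigr (fun k => (p (m.+1 + k).+1)%:E)) => [|k _]; last exact: pE.
rewrite sumEFin lee_fin; apply: le_trans (sumle (n + m.+1)%N).
rewrite [leRHS](@big_cat_nat _ _ _ m.+2)//= ?ltnS ?leq_addl//.
rewrite big_nat1 -[leLHS]add0r; apply: lerD => //.
rewrite -[in leRHS](add0n m.+2) -[(n + m.+1).+1]addnS big_addn addnK.
by apply: ler_sum => i _; rewrite (_ : (i + m.+2 = (m.+1 + i).+1)%N)//; lia.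
Qed.

End detection_delay.

(** * A lower bound on the delay of any procedure *)

Section lower_bound.
Context {R : realType} {dS d : measure_display} {S : measurableType dS}
  {Omega : measurableType d}.
Variables (X : nat -> Omega -> S) (mu : {measure set S -> \bar R}).
Variables (f g : nat -> S -> R) (T : nat).
Hypothesis T1 : (1 <= T)%N.
Hypothesis mX : forall n, (1 <= n)%N -> measurable_fun setT (X n).
Hypothesis fd : forall n, (1 <= n)%N -> is_density mu (f n).
Hypothesis gd : forall n, (1 <= n)%N -> is_density mu (g n).
Hypothesis fper : seq_periodic T f.
Hypothesis gper : seq_periodic T g.
Hypothesis KLfin : forall n, (1 <= n)%N -> KL mu (g n) (f n) < +oo.
Variables (Pinf : probability Omega R) (P : nat -> probability Omega R).
Hypothesis law_inf : has_law X mu Pinf f.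
Hypothesis law : forall nu, (1 <= nu)%N ->
  has_law X mu (P nu) (change_density f g nu).

(** Telescoping: only the first K terms survive. *)
Lemma window_sum_le (u : nat -> R) (K N : nat) :
  (forall i, 0 <= u i <= 1)%R ->
  (\sum_(0 <= i < N) (u i - u (i + K)%N) <= K%:R)%R.
Proof.
move=> u01; rewrite sumrB.
have -> : (\sum_(0 <= i < N) u (i + K)%N =
    \sum_(0 <= i < N + K) u i - \sum_(0 <= i < K) u i)%R.
  rewrite [in RHS](@big_cat_nat _ _ _ K) ?leq_addl//= [in RHS]addrAC subrr add0r.
  by rewrite -[in RHS](add0n K) big_addn addnK.
have h1 : (\sum_(0 <= i < K) u i <= K%:R)%R.
  rewrite (_ : K%:R = \sum_(0 <= i < K) 1)%R; last by rewrite sumr_const_nat subn0.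
  by apply: ler_sum => i _; have /andP[] := u01 i.
have h2 : (\sum_(0 <= i < N) u i <= \sum_(0 <= i < N + K) u i)%R.
  rewrite [leRHS](@big_cat_nat _ _ _ N) ?leq_addr//= lerDl sumr_ge0// => i _.
  by have /andP[] := u01 i.
lra.
Qed.

(** If every window were noisy, that is beta (q_(m+1) - q_(m+1+K)) > 2 K q_(m+1)
    whenever q_(m+1) > 0, then summing over m would telescope to
    2 K E[tau] <= beta K, against E[tau] >= beta. *)
Lemma exists_quiet_window (tau : Omega -> \bar R) (beta : R) (K : nat) :
  stopping_time X tau -> (0 < beta)%R -> (0 < K)%N ->
  beta%:E <= \int[Pinf]_w tau w ->
  let q i := fine (Pinf (not_before tau i)) in
  exists m, (0 < q m.+1)%R /\
    (beta * (q m.+1 - q (m.+1 + K)%N) <= 2 * K%:R * q m.+1)%R.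
Proof.
move=> st b0 K0 bE q; apply: contrapT => /forallNP hN.
have mN i := measurable_not_before mX i st.
have qE i : Pinf (not_before tau i) = (q i)%:E by rewrite fineK// fin_num_measure.
have q01 i : (0 <= q i <= 1)%R.
  by rewrite fine_ge0//= -lee_fin -qE probability_le1.
have qmono i j : (i <= j)%N -> (q j <= q i)%R.
  by move=> ij; rewrite -lee_fin -!qE le_measure ?inE//; exact: not_before_mono.
have big m : (2 * K%:R * q m.+1 <= beta * (q m.+1 - q (m.+1 + K)%N))%R.
  have [q0|q0] := ltP 0%R (q m.+1).
    by rewrite leNgt; apply/negP => h; apply: (hN m); split => //; exact: ltW.
  have /andP[h1 _] := q01 m.+1; have /andP[h2 _] := q01 (m.+1 + K)%N.
  have h3 := qmono _ _ (leq_addr K m.+1).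
  have -> : q m.+1 = 0%R by apply/eqP; rewrite eq_le q0.
  have -> : q (m.+1 + K)%N = 0%R by apply/eqP; rewrite eq_le h2 (le_trans h3).
  by rewrite subrr !mulr0.
have half N : (\sum_(0 <= i < N) q i.+1 <= beta / 2)%R.
  have h : (2 * K%:R * \sum_(0 <= i < N) q i.+1 <=
      beta * \sum_(0 <= i < N) (q i.+1 - q (i + K).+1))%R.
    by rewrite !mulr_sumr; apply: ler_sum => i _; rewrite -addSn; exact: big.
  have h2 := window_sum_le K N (fun i => q01 i.+1).
  have h3 := ler_wpM2l (ltW b0) h2.
  have K0' : (0 < K%:R :> R)%R by rewrite ltr0n.
  rewrite -(ler_pM2l (_ : 0 < 2 * K%:R)%R) ?mulr_gt0//.
  apply: le_trans h _; apply: le_trans h3 _.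
  lra.
have : beta%:E <= (beta / 2)%:E.
  apply: le_trans bE _.
  have := integral_excess mX Pinf 0%N st measurableT.
  under eq_integral => w _.
    rewrite sube0 (max_idPl _); last first.
      by have [->|[m ->]] := st.1 w; rewrite ?leey// lee_fin.
    over.
  move=> ->; apply: lime_le; first exact: is_cvg_nneseries.
  apply: nearW => n; rewrite (eq_bigr (fun k => (q k.+1)%:E)) => [|k _].
    by rewrite sumEFin lee_fin.
  by rewrite add0n setTI qE.
by rewrite lee_fin; lra.
Qed.

Let z i : S -> R := llr (g i) (f i).

Section fixed_change_point.
Variable m : nat.
Let Q := P m.+1.
Let lawQ : has_law X mu Q (change_density f g m.+1) := law (ltn0Sn m).

Let after i : (m < i)%N -> change_density f g m.+1 i = g i.
Proof. by move=> mi; rewrite /change_density ltnNge mi. Qed.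

Let pos i : (m < i)%N -> (1 <= i)%N.
Proof. exact: leq_ltn_trans. Qed.

(** The integral of v >= c + 1 - exp(c - v), where exp(- v) is the likelihood
    ratio of no change to change.  It compares the walk at a time with the
    probability of the event without change, and c is free. *)
Lemma entropy_step (V : Omega -> R) n B (c : R) : (m <= n)%N ->
  history X n B -> Q.-integrable setT (fun w => (V w)%:E) ->
  (forall w, B w -> V w = \sum_(m.+1 <= i < n.+1) z i (X i w))%R ->
  (c + 1)%:E * Q B - (expR c)%:E * Pinf B <= \int[Q]_(w in B) (V w)%:E.
Proof.
move=> mn hB iV VE; have mB := history_measurable mX hB.
pose L w := (\prod_(m.+1 <= i < n.+1)
  (f i (X i w) / change_density f g m.+1 i (X i w)))%R.
have cd := change_density_is_density fd gd m.+1.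
have LB : \int[Q]_(w in B) (L w)%:E <= Pinf B.
  apply: (change_of_measure_le mX fd cd law_inf lawQ) => // i /andP[_ im].
  by rewrite /change_density ltnS im.
have mL : measurable_fun setT (fun w => (L w)%:E).
  apply: (history_measurable_fun mX (n := n)).
  apply: (measurable_history_prod (X := X)
    (a := fun i x => f i x / change_density f g m.+1 i x)%R) => i /andP[mi _].
  by apply: (measurable_ratio (mu := mu)); [exact: fd (pos mi)|exact: cd (pos mi)].
have L0 w : (0 <= L w)%R.
  rewrite /L big_seq; apply: prodr_ge0 => i; rewrite mem_index_iota => /andP[mi _].
  have [_ f0 _] := fd (pos mi); have [_ c0 _] := cd i (pos mi).
  exact: divr_ge0.
have iL : Q.-integrable B (fun w => (L w)%:E).
  apply/integrableP; split; first exact: measurable_funTS.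
  rewrite (eq_integral (fun w => (L w)%:E)) => [|w _]; last first.
    by rewrite gee0_abs// lee_fin.
  apply: le_lt_trans LB _.
  by apply: le_lt_trans (probability_le1 _ _) (ltry _).
have iVB : Q.-integrable B (fun w => (V w)%:E) by apply: integrableS iV.
have ieL : Q.-integrable B (fun w => (expR c)%:E * (L w)%:E).
  exact: integrableZl.
have key : (c + 1)%:E * Q B <=
    \int[Q]_(w in B) ((V w)%:E + (expR c)%:E * (L w)%:E).
  rewrite -integral_cst//; apply: ae_le_integral_measurable => //.
    by apply: emeasurable_funD; [exact: measurable_int iVB|exact: measurable_int ieL].
  have := support_ae mX fd gd KLfin lawQ.
  apply: filterS => w good Bw; rewrite /= -EFinM -EFinD lee_fin.
  have -> : L w = expR (- V w).
    rewrite VE// -sumrN expR_sum /L big_seq [in RHS]big_seq.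
    apply: eq_bigr => i; rewrite mem_index_iota => /andP[mi _].
    have [gi fi] := good i mi.
    have [_ g0 _] := gd (pos mi); have [_ f0 _] := fd (pos mi).
    rewrite after// /z /llr -lnV ?posrE ?divr_gt0 ?lt_def ?gi ?fi ?g0 ?f0//.
    by rewrite invf_div lnK// posrE divr_gt0 ?lt_def ?gi ?fi ?g0 ?f0.
  by rewrite -expRD; have := expR_ge1Dx (c - V w); lra.
rewrite integralD// integralZl// in key.
rewrite leeBlDr; last by rewrite fin_numM// fin_num_measure.
apply: le_trans key _; by rewrite leeD2l// lee_wpmul2l// lee_fin expR_ge0.
Qed.

Variable tau : Omega -> \bar R.
Hypothesis st : stopping_time X tau.
Let D := not_before tau m.+1.
Let p i := fine (Q (not_before tau i)).
Let q i := fine (Pinf (not_before tau i)).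

Let mN i : measurable (not_before tau i).
Proof. exact: (measurable_not_before mX). Qed.

Let pE i : Q (not_before tau i) = (p i)%:E.
Proof. by rewrite fineK// fin_num_measure. Qed.

Let qE i : Pinf (not_before tau i) = (q i)%:E.
Proof. by rewrite fineK// fin_num_measure. Qed.

(** The walk stopped at tau or at the end of the window, whichever comes first,
    is integrated over the events that tau fires at a given time, and each piece
    is bounded by [entropy_step]: with the parameter c on alarms inside the
    window, and with 0 on the event that the window ends without alarm. *)
Lemma stopped_information_ge (K : nat) (c : R) :
  (((c + 1) * (p m.+1 - p (m.+1 + K)%N) - expR c * (q m.+1 - q (m.+1 + K)%N)
    + p (m.+1 + K)%N - q (m.+1 + K)%N) <=
  \sum_(m.+1 <= i < m.+1 + K) KL_num mu f g i * p i)%R.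
Proof.
have hT : history X m D by exact: history_not_before.
have /= [iV EV] := @wald_post_change _ _ _ _ _ X mu f g mX fd gd m Q lawQ
  z (KL_num mu f g) tau D (m + K)%N st hT
  (fun i mi => measurable_llr (gd (pos mi)) (fd (pos mi)))
  (fun i mi => integrable_llr (gd (pos mi)) (fd (pos mi)) (KLfin (pos mi)))
  (fun i mi => etrans (esym (KL_llrE (gd (pos mi)) (fd (pos mi)) (KLfin (pos mi))))
    (esym (fineK (KL_fin_num (gd (pos mi)) (fd (pos mi)) (KLfin (pos mi)))))).
set V := fun w => (\sum_(m.+1 <= i < (m + K).+1) z i (X i w) *
   \1_(not_before tau i) w)%R in iV EV.
rewrite addSn.
have EV' : \int[Q]_(w in D) (V w)%:E =
    (\sum_(m.+1 <= i < (m + K).+1) KL_num mu f g i * p i)%R%:E.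
  rewrite EV -sumEFin !big_seq; apply: eq_bigr => i; rewrite mem_index_iota => /andP[mi _].
  by rewrite (setIidr (not_before_mono mi)) pE.
rewrite -lee_fin -EV'.
have VE n w : (m <= n <= m + K)%N -> not_before tau n w ->
    (n = (m + K)%N \/ ~ not_before tau n.+1 w) ->
    (V w = \sum_(m.+1 <= i < n.+1) z i (X i w))%R.
  move=> /andP[mn nK] hn hn1.
  rewrite /V (@big_cat_nat _ _ _ n.+1)//= ?ltnS// [Z in (_ + Z)%R]big1_seq ?addr0.
    rewrite !big_seq; apply: eq_bigr => i; rewrite mem_index_iota ltnS => /andP[_ ni].
    by rewrite indicE mem_set ?mulr1//; exact: not_before_mono hn.
  move=> i /=; rewrite mem_index_iota => /andP[ni iK].
  case: hn1 => [nE|hn1]; first by move: iK; rewrite ltnS -nE leqNgt ni.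
  by rewrite indicE memNset ?mulr0// => hi; apply: hn1; exact: not_before_mono hi.
have VI i : \int[Q]_(w in not_before tau i) (V w)%:E \is a fin_num.
  by apply: integrable_fin_num => //; exact: integrableS iV.
have diffE (P' : probability Omega R) r i : (forall i, P' (not_before tau i) = (r i)%:E) ->
    P' (not_before tau i `\` not_before tau i.+1) = (r i - r i.+1)%:E.
  move=> rE; have sub := @not_before_mono _ _ _ tau _ _ (leqnSn i).
  have fin : P' (not_before tau i) < +oo by rewrite rE ltry.
  have := measureD (mN i) (mN i.+1) fin.
  by rewrite (setIidr sub) => ->; rewrite -[Z in Z - _ = _]/(P' _) -[Z in _ - Z = _]/(P' _) !rE.
have ind n : (m <= n <= m + K)%N ->
    ((c + 1) * (p m.+1 - p n.+1) - expR c * (q m.+1 - q n.+1))%:E +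
    \int[Q]_(w in not_before tau n.+1) (V w)%:E <= \int[Q]_(w in D) (V w)%:E.
  elim: n => [|n IH].
    by rewrite leqn0 => /andP[/eqP m0 _]; rewrite /D m0 !subrr !mulr0 subrr add0e.
  rewrite leq_eqVlt => /andP[/orP[/eqP mE _|]].
    by rewrite /D mE !subrr !mulr0 subrr add0e.
  rewrite ltnS => mn nK; have := IH _; rewrite mn (ltnW nK) => /(_ isT).
  apply: le_trans.
  have sub := @not_before_mono _ _ _ tau _ _ (leqnSn n.+1).
  have mB : measurable (not_before tau n.+1 `\` not_before tau n.+2).
    exact: measurableD.
  have -> : \int[Q]_(w in not_before tau n.+1) (V w)%:E =
     \int[Q]_(w in not_before tau n.+1 `\` not_before tau n.+2) (V w)%:E +
     \int[Q]_(w in not_before tau n.+2) (V w)%:E.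
    rewrite -[in LHS](setDUK sub) setUC integral_setU//.
    - by apply: measurable_funTS; exact: measurable_int iV.
    - by apply/disj_set2P; rewrite setDKI.
  have hB : history X n.+1 (not_before tau n.+1 `\` not_before tau n.+2).
    apply: historyD; last exact: history_not_before.
    by apply: (history_mono (leqnSn n)); exact: history_not_before.
  have hV w : (not_before tau n.+1 `\` not_before tau n.+2) w ->
      (V w = \sum_(m.+1 <= i < n.+2) z i (X i w))%R.
    by move=> [h1 h2]; apply: VE => //; [rewrite leqW|right].
  have := entropy_step c (leqW mn) hB iV hV.
  rewrite (diffE Q p _ pE) (diffE Pinf q _ qE).
  have : \int[Q]_(w in not_before tau n.+1 `\` not_before tau n.+2) (V w)%:E
      \is a fin_num.
    by apply: integrable_fin_num => //; exact: integrableS iV.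
  move: (VI n.+2); case: (\int[Q]_(w in not_before tau n.+2) _) => // v _.
  case: (\int[Q]_(w in _ `\` _) _) => // u _.
  by rewrite -!EFinM -!EFinB -!EFinD !lee_fin; lra.
have mnK : (m <= m + K <= m + K)%N by rewrite leq_addr leqnn.
have hlast : history X (m + K) (not_before tau (m + K).+1).
  exact: history_not_before.
have hV w : not_before tau (m + K).+1 w ->
    (V w = \sum_(m.+1 <= i < (m + K).+1) z i (X i w))%R.
  by move=> h; apply: VE => //; [exact: not_before_mono h|left].
have := ind _ mnK; apply: le_trans.
(* No alarm in the window: this event is not rare without change, so c = 0. *)
have := entropy_step 0 (leq_addr K m) hlast iV hV.
rewrite pE qE expR0 add0r !mul1e.
move: (VI (m + K).+1); case: (\int[Q]_(w in not_before tau (m + K).+1) _) => // v _.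
by rewrite -EFinB -!EFinD !lee_fin; lra.
Qed.

(** On the past before the change both laws coincide, so p = q at m + 1.  In a
    quiet window and for this c the term exp(c) (q_(m+1) - q_(m+1+K)) is at most
    q_(m+1).  Not having fired within the window costs a delay of K each time,
    which bounds c p_(m+1+K) by c / K times the delay. *)
Lemma condexp_event_delay_ge (K : nat) (beta : R) :
  let I := period_mean T (KL_num mu f g) in
  let dev := period_deviation T (KL_num mu f g) in
  let c := ln (beta / (2 * K%:R)) in
  (0 < I)%R -> (0 < K)%N -> (0 < beta)%R -> (0 <= c)%R -> (0 < q m.+1)%R ->
  (beta * (q m.+1 - q (m.+1 + K)%N) <= 2 * K%:R * q m.+1)%R ->
  p m.+1 = q m.+1 /\
  ((c - 1 - I - dev) / (I + c / K%:R))%:E <=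
  condexp_event Q D (fun w => tau w - m.+1%:R%:E).
Proof.
move=> I dev c I0 K0 b0 c0 q0 quiet.
have Kp : (0 < K%:R :> R)%R by rewrite ltr0n.
have pq : p m.+1 = q m.+1.
  rewrite /p /q; congr fine.
  apply: (eq_history_law mX lawQ law_inf (n := m)) => [i /andP[_ im]|].
    by rewrite /change_density ltnS im.
  exact: history_not_before.
split=> //.
have hD : history X m D by exact: history_not_before.
have mD := history_measurable mX hD.
have pmono i j : (i <= j)%N -> (p j <= p i)%R.
  by move=> ij; rewrite -lee_fin -!pE le_measure ?inE//; exact: not_before_mono.
have qmono i j : (i <= j)%N -> (q j <= q i)%R.
  by move=> ij; rewrite -lee_fin -!qE le_measure ?inE//; exact: not_before_mono.
have p0 i : (0 <= p i)%R by rewrite fine_ge0.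
have JE : \int[Q]_(w in D) (tau w - m.+1%:R%:E) =
    \sum_(k <oo) (p (m.+1 + k).+1)%:E.
  transitivity (\int[Q]_(w in D) maxe (tau w - m.+1%:R%:E) 0).
    apply: eq_integral => w; rewrite inE => Dw.
    by apply/esym/max_idPl; rewrite sube_ge0.
  rewrite (integral_excess mX Q m.+1 st mD); apply: eq_eseriesr => k _.
  by rewrite -pE (setIidr (not_before_mono _))// ltnS leqW// leq_addr.
have J0 : 0 <= \int[Q]_(w in D) (tau w - m.+1%:R%:E).
  by apply: integral_ge0 => w Dw; rewrite sube_ge0.
have Jge n : (\sum_(0 <= k < n) p (m.+1 + k).+1)%:E <= \int[Q]_(w in D) (tau w - m.+1%:R%:E).
  rewrite JE -sumEFin; apply: nneseries_lim_ge => k _ _.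
  by rewrite lee_fin.
rewrite /condexp_event pE pq inver gt_eqF//.
move: J0 Jge; case: (\int[Q]_(w in D) _) => [J| |//]; last first.
  by move=> _ _; rewrite gt0_mulye ?leey// lte_fin invr_gt0.
rewrite lee_fin => J0 Jge; rewrite -EFinM lee_fin.
have J1 : (K%:R * p (m.+1 + K)%N <= J)%R.
  have := Jge K; rewrite lee_fin; apply: le_trans.
  rewrite (_ : K%:R * _ = \sum_(0 <= k < K) p (m.+1 + K)%N)%R.
    rewrite !big_seq; apply: ler_sum => k; rewrite mem_index_iota => /andP[_ kK].
    by apply: pmono; rewrite -addnS leq_add2l.
  by rewrite sumr_const_nat subn0 mulr_natl.
have J2 : (\sum_(m.+1 <= i < m.+1 + K) p i <= p m.+1 + J)%R.
  have := Jge K.-1; rewrite lee_fin => h.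
  rewrite big_ltn ?ltnS; last by rewrite -[X in (X < _)%N]addn0 ltn_add2l.
  rewrite lerD2l; apply: le_trans h.
  rewrite -[in leLHS](add0n m.+2) big_addn.
  rewrite (_ : (m.+1 + K - m.+2 = K.-1)%N); last by lia.
  by apply: ler_sum => i _; rewrite addnC addSn.
have H1 := stopped_information_ge K c.
have a1 i : (1 <= i)%N -> KL_num mu f g (i + T)%N = KL_num mu f g i.
  exact: KL_num_periodic.
have pm i : (m < i)%N -> (0 <= p i.+1 <= p i)%R.
  by move=> _; rewrite p0 pmono.
have H2 := periodic_weighted_sum_le (m + K)%N T1 a1 pm (p0 m.+1).
rewrite -addSn -/I -/dev in H2.
have eK : (0 < beta / (2 * K%:R))%R by rewrite divr_gt0// mulr_gt0.
have ec : (expR c * (q m.+1 - q (m.+1 + K)%N) <= q m.+1)%R.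
  rewrite /c lnK ?posrE// mulrAC ler_pdivrMr ?mulr_gt0//.
  by rewrite [leRHS]mulrC.
have qK := qmono _ _ (leq_addr K m.+1).
set pi := q m.+1 in q0 pq quiet ec qK H1 *.
have cK : (0 <= c / K%:R)%R by rewrite divr_ge0// ltW.
rewrite ler_pdivrMr; last by rewrite ltr_wpDr.
rewrite mulrAC ler_pdivlMr//.
have H3 : (I * \sum_(m.+1 <= i < m.+1 + K) p i <= I * (pi + J))%R.
  by apply: ler_wpM2l; [exact: ltW|rewrite -pq].
have H4 : (c * p (m.+1 + K)%N <= c / K%:R * J)%R.
  by rewrite -mulrA ler_wpM2l// mulrC ler_pdivlMr// mulrC.
rewrite pq in H1 H2.
nra.
Qed.

End fixed_change_point.

Lemma pollak_delay_ge (tau : Omega -> \bar R) (beta : R) (K : nat) :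
  let I := period_mean T (KL_num mu f g) in
  let dev := period_deviation T (KL_num mu f g) in
  let c := ln (beta / (2 * K%:R)) in
  (0 < I)%R -> (0 < K)%N -> (0 < beta)%R -> (0 <= c)%R ->
  feasible X Pinf beta tau ->
  ((c - 1 - I - dev) / (I + c / K%:R))%:E <= pollak_delay P tau.
Proof.
move=> I dev c I0 K0 b0 c0 [st bE].
have [m [q0 quiet]] := exists_quiet_window st b0 K0 bE.
have [pq h] := condexp_event_delay_ge st I0 K0 b0 c0 q0 quiet.
apply: le_trans h _; apply: ereal_sup_ubound; exists m.+1 => //; split => //.
have mN := measurable_not_before mX m.+1 st.
by rewrite -(fineK (fin_num_measure (P m.+1) _ mN)) lte_fin pq.
Qed.

End lower_bound.

(** * Asymptotics in the false alarm constraint *)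

Section asymptotics.
Context {R : realType}.
Local Open Scope ring_scope.

Lemma near_ln_ge (C : R) : \forall b \near +oo, C <= ln b.
Proof.
near=> b.
have b0 : 0 < b by near: b; apply: nbhs_pinfty_gt; exact: num_real.
have Cb : expR C <= b by near: b; apply: nbhs_pinfty_ge; exact: num_real.
by rewrite -[C]expRK ler_ln ?posrE ?expR_gt0.
Unshelve. all: by end_near. Qed.

(** With s^2 = log b, the losses in the delay bound relative to
    log b / I are all of order 1 / s: the number 8 s bounds log(2 K), the
    constant 1 + I + dev is bounded, and k = c / K is at most 1 / s^2. *)
Lemma lower_ratio (I dev c k s : R) :
  0 < I -> 0 <= dev -> 1 <= s -> s ^+ 2 - 8 * s <= c -> 0 <= k <= s ^- 2 ->
  0 <= c - 1 - I - dev ->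
  1 - (8 + (1 + I + dev) + I^-1) / s <= (c - 1 - I - dev) / (I + k) * I / s ^+ 2.
Proof.
move=> I0 dev0 s1 hc /andP[k0 ks] h0.
have s0 : 0 < s by exact: lt_le_trans s1.
have s20 : 0 < s ^+ 2 by rewrite exprn_gt0.
set B := 8 + (1 + I + dev) + I^-1.
have BI : B * I = 8 * I + (1 + I + dev) * I + 1.
  by rewrite /B !mulrDl mulVf ?gt_eqF.
have rhs0 : 0 <= (c - 1 - I - dev) / (I + k) * I / s ^+ 2.
  by rewrite !mulr_ge0 ?invr_ge0// ltW// ltr_wpDr.
have [h|h] := leP (1 - B / s) 0; first exact: le_trans rhs0.
rewrite ler_pdivlMr// [leRHS]mulrAC ler_pdivlMr; last by rewrite ltr_wpDr.
have ks1 : s ^+ 2 * k <= 1 by rewrite mulrC -ler_pdivlMr// mul1r.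
apply: (@le_trans _ _ ((1 - B / s) * (I * s ^+ 2 + 1))).
  rewrite -mulrA ler_pM2l// mulrDr; lra.
have e : B / s * (I * s ^+ 2) = B * I * s.
  by rewrite expr2; field; rewrite gt_eqF.
have B0 : 0 <= B / s.
  have I0' := ltW I0.
  by apply: divr_ge0; [rewrite /B !addr_ge0 ?invr_ge0|exact: ltW].
rewrite mulrBl mul1r mulrDr e BI mulr1.
have v0 : 0 <= ((1 + I + dev) * I + 1) * (s - 1).
  have I0' := ltW I0.
  by apply: mulr_ge0; [rewrite addr_ge0// mulr_ge0// !addr_ge0|rewrite subr_ge0].
have cI := ler_wpM2r (ltW I0) hc.
lra.
Qed.

(** With K = trunc(t^2) + 1 and s the square root of t, 2 K <= 4 t^2 <= (2 s)^4, and ln(2 s) <= 2 s. *)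
Lemma ln_window_le (t : R) : 1 <= t ->
  ln (2 * (Num.truncn (t ^+ 2)).+1%:R) <= 8 * Num.sqrt t.
Proof.
move=> t1; have t0 : 0 < t by exact: lt_le_trans t1.
set s := Num.sqrt t; have s0 : 0 < s by rewrite sqrtr_gt0.
have st : s ^+ 2 = t by rewrite sqr_sqrtr// ltW.
have t21 : 1 <= t ^+ 2 by rewrite exprn_ege1.
have K1 : (Num.truncn (t ^+ 2)).+1%:R <= 2 * t ^+ 2.
  rewrite -addn1 natrD; have := truncn_le (t ^+ 2).
  by rewrite (ltW (lt_le_trans ltr01 t21)); lra.
have h : ln ((2 * s) ^+ 4) <= 8 * s.
  rewrite lnXn ?mulr_gt0//.
  have := ln_sublinear (mulr_gt0 (ltr0n R 2) s0); rewrite -mulr_natl; lra.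
apply: le_trans h; rewrite ler_ln ?posrE ?exprn_gt0 ?mulr_gt0//.
rewrite exprMn (_ : s ^+ 4 = t ^+ 2); last by rewrite -st -exprM.
have : (2 ^+ 4 = 16 :> R) by rewrite -natrX.
nra.
Qed.

End asymptotics.

Section operating_characteristics.
Context {R : realType} {dS d : measure_display} {S : measurableType dS}
  {Omega : measurableType d}.
Variables (X : nat -> Omega -> S) (mu : {measure set S -> \bar R}).
Variables (T M : nat) (f : nat -> S -> R) (g : 'I_M -> nat -> S -> R).
Hypothesis T1 : (1 <= T)%N.
Hypothesis M1 : (1 <= M)%N.
Hypothesis mX : forall n, (1 <= n)%N -> measurable_fun setT (X n).
Hypothesis fd : forall n, (1 <= n)%N -> is_density mu (f n).
Hypothesis gd : forall l n, (1 <= n)%N -> is_density mu (g l n).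
Hypothesis fper : seq_periodic T f.
Hypothesis gper : forall l, seq_periodic T (g l).
Hypothesis KLfin : forall l n, (1 <= n)%N -> KL mu (g l n) (f n) < +oo.
Variables (l : 'I_M) (Pinf : probability Omega R) (P : nat -> probability Omega R).
Hypothesis law_inf : has_law X mu Pinf f.
Hypothesis law : forall nu, (1 <= nu)%N ->
  has_law X mu (P nu) (change_density f (g l) nu).

Let I := period_mean T (KL_num mu f (g l)).
Hypothesis I0 : (0 < I)%R.

(** The cap is chosen first, large enough for the mean of the capped increments
    to be close to I; log b then dominates the constants, which depend on the
    cap. *)
Lemma lorden_tau_cm_near (delta : R) : (0 < delta)%R ->
  \forall b \near +oo%R,
    lorden_delay X P (tau_cm X f g b) <= (ln b / I * (1 + delta))%:E.
Proof.
move=> d0; have d2 : (1 < 1 + delta / 2)%R by rewrite ltrDl divr_gt0.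
have [n hn] : exists n : nat,
    (I / (1 + delta / 2) < period_mean T (capped_mean mu f (g l) n%:R))%R.
  have lt_I : (I / (1 + delta / 2) < I)%R.
    by rewrite ltr_pdivrMr ?(lt_trans ltr01)// ltr_pMr.
  have := cvgr_gt _ (capped_period_mean_cvg (T := T) fd (gd l) (KLfin l)) _ lt_I.
  by move=> [n _ h]; exists n; apply: h => /=.
set a := capped_mean mu f (g l) n%:R in hn.
have a0 : (0 < period_mean T a)%R.
  by apply: lt_trans hn; rewrite divr_gt0// (lt_trans ltr01).
pose C := (ln M%:R + n%:R + period_deviation T a)%R.
near=> b.
have b1 : (1 <= b)%R.
  by near: b; apply: nbhs_pinfty_ge; exact: num_real.
have b0 : (0 < b)%R by exact: lt_le_trans b1.
have Mge1 : (1 <= M%:R :> R)%R by rewrite ler1n.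
have M0 : (0 < M%:R :> R)%R by rewrite ltr0n.
have bM : (1 <= b * M%:R)%R by exact: mulr_ege1.
apply: le_trans (lorden_tau_cm_le T1 mX fd gd fper gper KLfin law (ler0n R n) bM a0) _.
rewrite lee_fin lnM ?posrE// ler_pdivrMr//.
have hb : ((1 + delta / 2) * C <= delta / 2 * ln b)%R.
  rewrite mulrC -ler_pdivlMr; last exact: lt_trans d2.
  rewrite mulrAC -ler_pdivrMl ?divr_gt0//; last first.
    by rewrite (lt_trans ltr01).
  by near: b; exact: near_ln_ge.
have lnb0 : (0 <= ln b)%R by exact: ln_ge0.
have C0 : (0 <= C)%R by rewrite /C !addr_ge0 ?ln_ge0// period_deviation_ge0.
have h1 : (1 <= (1 + delta / 2) * (period_mean T a / I))%R.
  rewrite mulrA ler_pdivlMr// mul1r mulrC -ler_pdivrMr ?(lt_trans ltr01)//.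
  exact: ltW.
have h2 : ((1 + delta / 2) * (ln b + C) <= (1 + delta) * ln b)%R by lra.
have -> : (ln b / I * (1 + delta) * period_mean T a =
    (1 + delta) * ln b * (period_mean T a / I))%R by ring.
rewrite (_ : ln b + ln M%:R + n%:R + _ = ln b + C)%R; last by rewrite /C !addrA.
apply: (@le_trans _ _ ((1 + delta / 2) * (ln b + C) * (period_mean T a / I))%R).
  by rewrite mulrAC -[leLHS]mul1r; apply: ler_wpM2r => //; exact: addr_ge0.
by rewrite ler_wpM2r// divr_ge0// ltW.
Unshelve. all: by end_near. Qed.

(** The error term is the relative excess of the delay over log b / I, cut off
    at 0 so that the errors of several hypotheses can be added. *)
Lemma lorden_tau_cm_asymptotics : exists e : R -> R,
  [/\ vanishes_at_infinity e, (forall b, (0 <= e b)%R) &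
    \forall b \near +oo%R,
      lorden_delay X P (tau_cm X f g b) <= (ln b / I * (1 + e b))%:E].
Proof.
pose e b := Num.max 0%R
  (fine (lorden_delay X P (tau_cm X f g b)) * I / ln b - 1)%R.
exists e; split.
- apply/cvgr0Pnorm_le => delta d0; near=> b.
  have lnb : (1 <= ln b)%R by near: b; exact: near_ln_ge.
  have lnb0 : (0 < ln b)%R by exact: lt_le_trans lnb.
  rewrite ger0_norm ?le_max ?lexx// ge_max ltW//= lerBlDr.
  have : lorden_delay X P (tau_cm X f g b) <= (ln b / I * (1 + delta))%:E.
    by near: b; exact: lorden_tau_cm_near.
  case: (lorden_delay _ _ _) => [r|//|_] /=; last by rewrite !mul0r; lra.
  rewrite lee_fin ler_pdivrMr// -ler_pdivlMr// => /le_trans; apply.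
  by rewrite mulrAC (mulrC _ (1 + delta)%R) (addrC 1%R).
- by move=> b; rewrite le_max lexx.
- near=> b.
  have lnb : (1 <= ln b)%R by near: b; exact: near_ln_ge.
  have lnb0 : (0 < ln b)%R by exact: lt_le_trans lnb.
  have : lorden_delay X P (tau_cm X f g b) <= (ln b / I * (1 + 1))%:E.
    by near: b; exact: lorden_tau_cm_near.
  rewrite /e; case: (lorden_delay _ _ _) => [r|//|_]; last by rewrite leNye.
  move=> _; rewrite lee_fin mulrC -ler_pdivrMr ?divr_gt0// -lerBlDl le_max.
  by apply/orP; right; rewrite /= invf_div mulrA.
Unshelve. all: by end_near. Qed.

(** The window K of order (log b)^2 is long enough for c / K to vanish and short
    enough for log K to be negligible against log b. *)
Lemma pollak_lower_asymptotics : exists e : R -> R,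
  [/\ vanishes_at_infinity e, (forall b, (e b <= 0)%R) &
    \forall b \near +oo%R, forall tau, feasible X Pinf b tau ->
      (ln b / I * (1 + e b))%:E <= pollak_delay P tau].
Proof.
pose dev := period_deviation T (KL_num mu f (g l)).
have dev0 : (0 <= dev)%R by exact: period_deviation_ge0.
pose K (b : R) := (Num.truncn (ln b ^+ 2)).+1.
pose c (b : R) := ln (b / (2 * (K b)%:R)).
pose low (b : R) := ((c b - 1 - I - dev) / (I + c b / (K b)%:R))%R.
pose e b := Num.min 0%R (low b * I / ln b - 1)%R.
have Kp b : (0 < (K b)%:R :> R)%R by rewrite ltr0n.
have facts : \forall b \near +oo%R,
    [/\ (0 < b)%R, (1 <= Num.sqrt (ln b))%R, (ln b - 8 * Num.sqrt (ln b) <= c b)%R,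
     (0 <= c b / (K b)%:R <= (ln b)^-1)%R & (0 <= c b - 1 - I - dev)%R].
  near=> b.
  have b1 : (1 <= b)%R by near: b; apply: nbhs_pinfty_ge; exact: num_real.
  have b0 : (0 < b)%R by exact: lt_le_trans b1.
  pose s := Num.sqrt (ln b).
  have lnb : ((9 + (1 + I + dev)) ^+ 2 <= ln b)%R by near: b; exact: near_ln_ge.
  have u0 : (0 <= 9 + (1 + I + dev))%R by rewrite !addr_ge0// ltW.
  have lnb0 : (0 <= ln b)%R by apply: le_trans lnb; exact: sqr_ge0.
  have sE : (s ^+ 2 = ln b)%R by rewrite sqr_sqrtr.
  have su : (9 + (1 + I + dev) <= s)%R.
    by rewrite -(ger0_norm u0) -sqrtr_sqr ler_wsqrtr.
  have s1 : (1 <= s)%R by apply: le_trans su; have := ltW I0; lra.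
  have t1 : (1 <= ln b)%R by rewrite -sE exprn_ege1.
  have cE : (c b = ln b - ln (2 * (K b)%:R))%R.
    by rewrite /c ln_div// posrE// mulr_gt0.
  have cge : (ln b - 8 * s <= c b)%R by rewrite cE lerD2l lerN2 ln_window_le.
  have cle : (c b <= ln b)%R.
    rewrite cE gerBl ln_ge0//; have : (1 <= (K b)%:R :> R)%R by rewrite ler1n.
    by lra.
  have c0 : (0 <= c b - 1 - I - dev)%R.
    apply: (@le_trans _ _ (ln b - 8 * s - 1 - I - dev)%R); last by lra.
    have h1 : (0 <= (s - (9 + (1 + I + dev))) * s)%R by rewrite mulr_ge0 ?subr_ge0// (le_trans ler01).
    have h2 : (0 <= (1 + (1 + I + dev)) * (s - 1))%R.
      by rewrite mulr_ge0 ?subr_ge0// !addr_ge0// ltW.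
    rewrite -sE; nra.
  split => //; apply/andP; split.
    by rewrite divr_ge0//; have := ltW I0; lra.
  rewrite ler_pdivrMr// mulrC.
  have tp : (0 < ln b)%R by exact: lt_le_trans t1.
  rewrite ler_pdivlMr//; apply: le_trans (ltW (truncnS_gt _)).
  by rewrite expr2 ler_wpM2r.
exists e; split.
- apply/cvgr0Pnorm_le => delta d0; near=> b.
  have [b0 s1 cge ck c0] : [/\ (0 < b)%R, (1 <= Num.sqrt (ln b))%R,
      (ln b - 8 * Num.sqrt (ln b) <= c b)%R,
      (0 <= c b / (K b)%:R <= (ln b)^-1)%R & (0 <= c b - 1 - I - dev)%R].
    by near: b; exact: facts.
  pose B := (8 + (1 + I + dev) + I^-1)%R.
  have B0 : (0 <= B)%R by rewrite /B !addr_ge0// ?invr_ge0 ltW.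
  have lnb : ((B / delta) ^+ 2 <= ln b)%R by near: b; exact: near_ln_ge.
  have lnb0 : (0 <= ln b)%R by apply: le_trans lnb; exact: sqr_ge0.
  set s := Num.sqrt (ln b) in s1 cge.
  have sE : (s ^+ 2 = ln b)%R by rewrite sqr_sqrtr.
  have s0 : (0 < s)%R by exact: lt_le_trans s1.
  have sB : (B / s <= delta)%R.
    rewrite ler_pdivrMr// mulrC -ler_pdivrMr//.
    have Bd : (0 <= B / delta)%R by rewrite divr_ge0// ltW.
    by rewrite -(ger0_norm Bd) -sqrtr_sqr ler_wsqrtr.
  rewrite -sE in cge ck.
  have := lower_ratio I0 dev0 s1 cge ck c0; rewrite sE -/B => h.
  rewrite ler0_norm ?ge_min ?lexx// lerNl le_min; apply/andP; split.
    by rewrite oppr_le0 ltW.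
  rewrite /low; lra.
- by move=> b; rewrite ge_min lexx.
- near=> b => tau feas.
  have [b0 s1 cge ck c0] : [/\ (0 < b)%R, (1 <= Num.sqrt (ln b))%R,
      (ln b - 8 * Num.sqrt (ln b) <= c b)%R,
      (0 <= c b / (K b)%:R <= (ln b)^-1)%R & (0 <= c b - 1 - I - dev)%R].
    by near: b; exact: facts.
  have lnb0 : (0 < ln b)%R by rewrite -sqrtr_gt0 (lt_le_trans _ s1).
  have c00 : (0 <= c b)%R by have := ltW I0; lra.
  apply: le_trans (pollak_delay_ge T1 mX fd (gd l) fper (gper l) (KLfin l)
    law_inf law I0 (ltn0Sn _) b0 c00 feas).
  rewrite lee_fin mulrC -ler_pdivlMr ?divr_gt0// -lerBrDl ge_min.
  by apply/orP; right; rewrite /e /low /= invf_div !mulrA lexx.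
Unshelve. all: by end_near. Qed.

End operating_characteristics.

(** * From the bounds to optimality *)

Section assembly.
Context {R : realType} {dS d : measure_display} {S : measurableType dS}
  {Omega : measurableType d}.
Variables (X : nat -> Omega -> S) (mu : {measure set S -> \bar R}).

(** No divergence equals -oo, so a finite sum of them has no infinite term;
    periodicity extends this to all indices. *)
Lemma information_KL_lty (T : nat) (f g : nat -> S -> R) :
  (1 <= T)%N ->
  (forall n, (1 <= n)%N -> is_density mu (f n)) ->
  (forall n, (1 <= n)%N -> is_density mu (g n)) ->
  seq_periodic T f -> seq_periodic T g ->
  information mu T g f < +oo ->
  forall n, (1 <= n)%N -> KL mu (g n) (f n) < +oo.
Proof.
move=> T1 fd gd fper gper fin.
have Ny i : (1 <= i)%N -> -oo < KL mu (g i) (f i).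
  by move=> i1; exact: (KL_gtNy (gd i i1) (fd i i1)).
have base i : (1 <= i <= T)%N -> KL mu (g i) (f i) < +oo.
  move=> /andP[i1 iT]; rewrite ltey; apply/eqP => Ky.
  move: fin; rewrite /information (bigD1_seq i)/= ?mem_index_iota ?i1 ?ltnS ?iota_uniq//.
  rewrite Ky addye.
    by rewrite gt0_muley// lte_fin invr_gt0 ltr0n.
  rewrite -ltNye big_seq_cond; elim/big_ind : _ => [||j]; first by rewrite ltNyr.
    by move=> [x| |] [y| |] //= _ _; exact: ltNyr.
  by rewrite mem_index_iota => /andP[/andP[j1 _] _]; exact: Ny.
elim/ltn_ind => n IH n1; have [nT|Tn] := leqP n T; first by apply: base; rewrite n1.
have nT0 : (1 <= n - T)%N by rewrite subn_gt0.
rewrite -(subnK (ltnW Tn)) (fper _ nT0) (gper _ nT0); apply: IH => //.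
by rewrite -[ltnRHS]subn0 ltn_sub2l// (leq_trans T1)// ltnW.
Qed.

(** A procedure whose delay meets a universal lower bound up to 1 + o(1) is
    asymptotically optimal, with the quotient of the two error terms as excess. *)
Lemma asymptotic_optimality (M : nat) (Pinf : probability Omega R) (I : 'I_M -> R)
    (delay : 'I_M -> (Omega -> \bar R) -> \bar R) (tau : R -> Omega -> \bar R)
    (eu el : R -> R) :
  (forall l, (0 < I l)%R) ->
  vanishes_at_infinity eu -> vanishes_at_infinity el ->
  (\forall b \near +oo%R, feasible X Pinf b (tau b) /\
    forall l, delay l (tau b) <= (ln b / I l * (1 + eu b))%:E) ->
  (\forall b \near +oo%R, forall l t, feasible X Pinf b t ->
    (ln b / I l * (1 + el b))%:E <= delay l t) ->
  asymptotically_optimal X Pinf I delay tau.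
Proof.
move=> I0 eu0 el0 up low.
have near_lt (e : R -> R) : vanishes_at_infinity e ->
    \forall b \near +oo%R, (`|e b| <= 2^-1)%R.
  by move=> /cvgr0Pnorm_le; apply; rewrite invr_gt0.
exists (fun b => (1 + eu b) / (1 + el b) - 1)%R, el; split => //.
- have : ((1 + eu b) / (1 + el b) - 1)%R @[b --> +oo%R] -->
      ((1 + 0) / (1 + 0) - 1 : R)%R.
    apply: cvgB; last exact: cvg_cst.
    apply: cvgM; first by apply: cvgD => //; exact: cvg_cst.
    apply: cvgV; first by rewrite addr0 oner_eq0.
    by apply: cvgD => //; exact: cvg_cst.
  by rewrite addr0 divr1 subrr.
- near=> b.
  have hu : (`|eu b| <= 2^-1)%R by near: b; exact: near_lt.
  have hl : (`|el b| <= 2^-1)%R by near: b; exact: near_lt.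
  have [feas U] : feasible X Pinf b (tau b) /\
    forall l, delay l (tau b) <= (ln b / I l * (1 + eu b))%:E by near: b.
  have L : forall l t, feasible X Pinf b t ->
    (ln b / I l * (1 + el b))%:E <= delay l t by near: b.
  split => // l /=.
  have lowopt : (ln b / I l * (1 + el b))%:E <=
      ereal_inf [set delay l t | t in feasible X Pinf b].
    by apply: le_ereal_inf_tmp => _ [t ft <-]; exact: L.
  split => //.
  have u1 : (0 <= 1 + eu b)%R by move: hu; rewrite ler_norml => /andP[]; lra.
  have l1 : (0 < 1 + el b)%R by move: hl; rewrite ler_norml => /andP[]; lra.
  apply: (@le_trans _ _ (((1 + eu b) / (1 + el b))%:E *
    (ln b / I l * (1 + el b))%:E)).
    apply: le_trans (U l) _; rewrite -EFinM lee_fin.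
    by rewrite [leRHS]mulrCA divfK ?gt_eqF.
  have -> : (1 + ((1 + eu b) / (1 + el b) - 1) = (1 + eu b) / (1 + el b))%R.
    by rewrite addrC subrK.
  by apply: lee_wpmul2l => //; rewrite lee_fin divr_ge0// ltW.
Unshelve. all: by end_near. Qed.

End assembly.

Theorem theorem4p1 (R : realType)
    (dS : measure_display) (S : measurableType dS)
    (mu : {sigma_finite_measure set S -> \bar R})
    (d : measure_display) (Omega : measurableType d)
    (X : nat -> Omega -> S)
    (T M : nat) (f : nat -> S -> R) (g : 'I_M -> nat -> S -> R)
    (Pinf : probability Omega R) (P : 'I_M -> nat -> probability Omega R)
    (T_ge1 : (1 <= T)%N) (M_ge1 : (1 <= M)%N)
    (f_density : forall n, (1 <= n)%N -> is_density mu (f n))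
    (f_periodic : seq_periodic T f)
    (g_density : forall l n, (1 <= n)%N -> is_density mu (g l n))
    (g_periodic : forall l, seq_periodic T (g l))
    (I_pos_fin : forall l, 0 < information mu T (g l) f < +oo)
    (X_measurable : forall n, (1 <= n)%N -> measurable_fun setT (X n))
    (Pinf_law : has_law X mu Pinf f)
    (P_law : forall l nu, (1 <= nu)%N ->
       has_law X mu (P l nu) (change_density f (g l) nu)) :
  let I l := fine (information mu T (g l) f) in
  let Rn := R_stat X f g in
  let tsr := tau_sr X f g in
  let tcm := tau_cm X f g in
  [/\ martingale Pinf (history X) (fun n w => Rn n w - (n * M)%:R%:E),
      (forall beta : R, (0 < beta)%R ->
         \int[Pinf]_w stopped Rn (tsr beta) w < +oo ->
         \int[Pinf]_w tsr beta w <= \int[Pinf]_w tcm beta w /\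
         beta%:E <= \int[Pinf]_w tsr beta w),
      (forall l,
         (forall beta : R, (0 < beta)%R ->
            pollak_delay (P l) (tcm beta) <= lorden_delay X (P l) (tcm beta)) /\
         exists2 e : R -> R, vanishes_at_infinity e &
           \forall beta \near +oo%R,
             lorden_delay X (P l) (tcm beta) <=
             (ln beta / I l * (1 + e beta))%:E) &
      ((\forall beta \near +oo%R,
          \int[Pinf]_w stopped Rn (tsr beta) w < +oo) ->
       asymptotically_optimal X Pinf I (fun l => lorden_delay X (P l)) tcm /\
       asymptotically_optimal X Pinf I (fun l => pollak_delay (P l)) tcm)].
Proof.
move=> I Rn tsr tcm.
have KLfin l : forall n, (1 <= n)%N -> KL mu (g l n) (f n) < +oo.
  have /andP[_ fin] := I_pos_fin l.
  exact: (information_KL_lty T_ge1 f_density (g_density l) f_periodic (g_periodic l) fin).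
have IE l : I l = period_mean T (KL_num mu f (g l)).
  exact: (information_mean T f_density (g_density l) (KLfin l)).
have I0 l : (0 < I l)%R by rewrite /I fine_gt0.
have I0' l : (0 < period_mean T (KL_num mu f (g l)))%R by rewrite -IE.
have tcm_st b : stopping_time X (tcm b) by exact: (tau_cm_stopping X f_density g_density).
have tsr_st b : stopping_time X (tsr b) by exact: (tau_sr_stopping X f_density g_density).
have mean_mono b : (0 < b)%R -> \int[Pinf]_w tsr b w <= \int[Pinf]_w tcm b w.
  move=> b0; apply: ge0_le_integral => //.
  - by move=> w _; have [->|[m ->]] := (tsr_st b).1 w; rewrite ?leey// lee_fin.
  - exact: (measurable_stopping_time X_measurable (tsr_st b)).
  - exact: (measurable_stopping_time X_measurable (tcm_st b)).
  - by move=> w _; exact: (tau_sr_le_tau_cm X f_density g_density).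
have mean_ge b : (0 < b)%R -> b%:E <= \int[Pinf]_w tsr b w.
  by move=> b0; exact: (tau_sr_mean_ge X_measurable f_density g_density KLfin Pinf_law).
have upper l := lorden_tau_cm_asymptotics T_ge1 M_ge1 X_measurable f_density
  g_density f_periodic g_periodic KLfin (P_law l) (I0' l).
have lower l := pollak_lower_asymptotics T_ge1 X_measurable f_density g_density
  f_periodic g_periodic KLfin Pinf_law (P_law l) (I0' l).
split.
- exact: (R_stat_martingale X_measurable f_density g_density KLfin Pinf_law).
- by move=> b b0 _; split; [exact: mean_mono|exact: mean_ge].
- move=> l; split=> [b b0|]; first exact: pollak_le_lorden.
  by have [e [e0 _ he]] := upper l; exists e => //; rewrite IE.
move=> _.
have /choice[eu heu] := upper; have /choice[el hel] := lower.
pose Eu b := (\sum_(l < M) eu l b)%R; pose El b := (\sum_(l < M) el l b)%R.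
have Eu0 : vanishes_at_infinity Eu.
  have : Eu b @[b --> +oo%R] --> (\sum_(l < M) 0)%R.
    by apply: cvg_sum_seq => l _; have [] := heu l.
  by rewrite big1.
have El0 : vanishes_at_infinity El.
  have : El b @[b --> +oo%R] --> (\sum_(l < M) 0)%R.
    by apply: cvg_sum_seq => l _; have [] := hel l.
  by rewrite big1.
have euE l b : (eu l b <= Eu b)%R.
  rewrite /Eu (bigD1 l)//= lerDl sumr_ge0// => k _.
  by have [_ h _] := heu k; exact: h.
have elE l b : (El b <= el l b)%R.
  rewrite /El (bigD1 l)//= gerDl sumr_le0// => k _.
  by have [_ h _] := hel k; exact: h.
have up : \forall b \near +oo%R, feasible X Pinf b (tcm b) /\
    forall l, lorden_delay X (P l) (tcm b) <= (ln b / I l * (1 + Eu b))%:E.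
  near=> b.
  have b1 : (1 <= b)%R by near: b; apply: nbhs_pinfty_ge; exact: num_real.
  have b0 : (0 < b)%R by exact: lt_le_trans b1.
  split; first by split=> //; exact: le_trans (mean_ge b b0) (mean_mono b b0).
  have hb : forall l, lorden_delay X (P l) (tcm b) <=
      (ln b / period_mean T (KL_num mu f (g l)) * (1 + eu l b))%:E.
    by near: b; apply: filter_forall => l; have [] := heu l.
  move=> l; apply: le_trans (hb l) _; rewrite -IE lee_fin ler_wpM2l ?lerD2l//.
  by rewrite divr_ge0 ?ln_ge0// ltW.
have low : \forall b \near +oo%R, forall l t, feasible X Pinf b t ->
    (ln b / I l * (1 + El b))%:E <= pollak_delay (P l) t.
  near=> b.
  have b1 : (1 <= b)%R by near: b; apply: nbhs_pinfty_ge; exact: num_real.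
  have hb : forall l t, feasible X Pinf b t ->
      (ln b / period_mean T (KL_num mu f (g l)) * (1 + el l b))%:E <=
      pollak_delay (P l) t.
    by near: b; apply: filter_forall => l; have [] := hel l.
  move=> l t ft; apply: le_trans (hb l t ft); rewrite -IE lee_fin ler_wpM2l ?lerD2l//.
  by rewrite divr_ge0 ?ln_ge0// ltW.
split; apply: (asymptotic_optimality I0 Eu0 El0).
- exact: up.
- near=> b => l t ft; apply: le_trans (pollak_le_lorden X_measurable (P l) ft.1).
  by move: l t ft; near: b.
- near=> b; have [feas U] : feasible X Pinf b (tcm b) /\
    forall l, lorden_delay X (P l) (tcm b) <= (ln b / I l * (1 + Eu b))%:E by near: b.
  split=> // l; apply: le_trans (U l).
  exact: pollak_le_lorden.
- exact: low.
Unshelve. all: by end_near. Qed.
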